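(* Let $R$ be a commutative ring with unity which is finitely generated as an abelian group. Let $X\subseteq R$ be a finite set generating $R$ as an abelian group and let $Y=\{(x,1): x\in X\}\subseteq\Gamma_2(R)$. Then there is an algorithm which, given two elements $u,v$ of $\Gamma_2(R)$ as words on $Y\cup Y^{-1}$, determines whether $u$ and $v$ are conjugate in $\Gamma_2(R)$, and furthermore, when they are conjugate, produces a conjugator $\gamma\in\Gamma_2(R)$ (that is, $\gamma u=v\gamma$), and that runs in time $O(n^2)$, where $n=|u|_Y+|v|_Y$ and $|u|_Y$, $|v|_Y$ are the lengths of the input words on $Y\cup Y^{-1}$ representing $u$ and $v$.
   Context: For a commutative ring $R$ with unity, $\Gamma_2(R)$ denotes the group $R[t,t^{-1}]\rtimes \mathbb{Z}$, where $\mathbb{Z}$ acts on the additive group of Laurent polynomials $R[t,t^{-1}]$ by multiplication by $t$. Its elements are written as pairs $(P,k)$ with $P\in R[t,t^{-1}]$, $k\in\mathbb{Z}$, with multiplication $(P,k)(Q,l)=(P+t^kQ,\,k+l)$; equivalently $(P,k)$ is the matrix $\begin{pmatrix} t^k & P\\ 0&1\end{pmatrix}$. A conjugator produced by the algorithm is given as such a pair. The ring $R$ and the set $X$ are fixed and are not part of the input. *)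

(* Defs.v *)
From HB Require Import structures.
From mathcomp Require Import all_boot all_algebra all_fingroup.
From mathcomp Require Import finmap.
From mathcomp.multinomials Require Import monalg.

Set Implicit Arguments.
Unset Strict Implicit.
Unset Printing Implicit Defensive.

Import GRing.Theory.
Local Open Scope ring_scope.

(* Only the additive group of R[t,t^-1] and the multiplication by powers of t
   enter the group law of Gamma_2(R).  The ring structure that monalg puts on
   {malg R[K]} needs a monoid K without inverses, which excludes K = int, but
   its additive structure does not: P@_i is the coefficient of t^i in P, and
   << r *g i >> is r t^i. *)
Definition laurent (R : comPzRingType) := {malg R[int]}.

Definition tmul (R : comPzRingType) (k : int) (P : laurent R) : laurent R :=
  \sum_(i <- msupp P) << P@_i *g k + i >>.

Section LaurentTheory.
Variable R : comPzRingType.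
Implicit Types (P Q : laurent R) (k l : int).

Lemma coef_tmul k P i : (tmul k P)@_i = P@_(i - k).
Proof.
rewrite /tmul raddf_sum /=.
under eq_bigr => j _ do rewrite mcoeffU.
have [iP|iP] := boolP (i - k \in msupp P).
  rewrite (big_rem _ iP) /= [k + _]addrC subrK eqxx big1_seq ?addr0 // => j.
  rewrite mem_rem_uniq ?fset_uniq // => /andP[_ /andP[/= ji _]].
  by rewrite -[i](subrK k) [k + j]addrC (inj_eq (addIr k)) (negPf ji).
rewrite big1_seq ?mcoeff_outdom // => j /andP[_ jP].
case: eqP => [ij|//]; move: iP jP; rewrite -ij [k + j]addrC addrK.
by move=> /negPf ->.
Qed.

Lemma tmulD k P Q : tmul k (P + Q) = tmul k P + tmul k Q.
Proof. by apply/malgP => i; rewrite mcoeffD !coef_tmul mcoeffD. Qed.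

Lemma tmulN k P : tmul k (- P) = - tmul k P.
Proof. by apply/malgP => i; rewrite mcoeffN !coef_tmul mcoeffN. Qed.

Lemma tmul0 P : tmul 0 P = P.
Proof. by apply/malgP => i; rewrite coef_tmul subr0. Qed.

Lemma tmul_tmul k l P : tmul k (tmul l P) = tmul (k + l) P.
Proof. by apply/malgP => i; rewrite !coef_tmul opprD addrA. Qed.

End LaurentTheory.

Definition gamma2 (R : comPzRingType) := (laurent R * int)%type.

HB.instance Definition _ (R : comPzRingType) := Choice.on (gamma2 R).

Section Gamma2Group.
Variable R : comPzRingType.
Implicit Types a b c : gamma2 R.

Definition gamma2_mul a b : gamma2 R := (a.1 + tmul a.2 b.1, a.2 + b.2).
Definition gamma2_one : gamma2 R := (0, 0).
Definition gamma2_inv a : gamma2 R := (- tmul (- a.2) a.1, - a.2).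

Lemma gamma2_mulA : associative gamma2_mul.
Proof.
move=> a b c; rewrite /gamma2_mul /=.
by rewrite tmulD tmul_tmul !addrA.
Qed.

Lemma gamma2_mul1 : left_id gamma2_one gamma2_mul.
Proof. by case=> P k; rewrite /gamma2_mul /= tmul0 !add0r. Qed.

Lemma gamma2_mulr1 : right_id gamma2_one gamma2_mul.
Proof.
case=> P k; rewrite /gamma2_mul /= addr0; congr (_, _).
by apply/malgP => i; rewrite mcoeffD coef_tmul mcoeff0 addr0.
Qed.

Lemma gamma2_mulV : left_inverse gamma2_one gamma2_inv gamma2_mul.
Proof. by case=> P k; rewrite /gamma2_mul /= !addNr. Qed.

Lemma gamma2_mulrV : right_inverse gamma2_one gamma2_inv gamma2_mul.
Proof.
by case=> P k; rewrite /gamma2_mul /= tmulN tmul_tmul subrr tmul0 subrr.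
Qed.

HB.instance Definition _ :=
  isGroup.Build (gamma2 R) gamma2_mulA gamma2_mul1 gamma2_mulr1
    gamma2_mulV gamma2_mulrV.

End Gamma2Group.

Section Words.
Variables (R : comPzRingType) (X : {fset R}).

Definition lincomb (c : {ffun X -> int}) : R := \sum_(x : X) val x *~ c x.

Definition generates_additively : Prop := forall r : R, exists c, r = lincomb c.

(* (x, true) stands for the generator (x,1) of Gamma_2(R), (x, false) for its
   inverse; words need not be reduced. *)
Definition word := seq (X * bool).

Definition letter_value (l : X * bool) : gamma2 R :=
  let y : gamma2 R := (<< val l.1 *g 0 >>, 1) in
  (if l.2 then y else y^-1)%g.

Definition word_value (w : word) : gamma2 R :=
  (\prod_(l <- w) letter_value l)%g.

End Words.

(* The model of computation is the random access machine of Cook and Reckhow: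
   registers X_0, X_1, X_2, ... holding integers, initially 0, a read-only
   input tape and a write-only output tape of integers, and unit cost for each
   executed instruction. *)
Inductive instr :=
| Iconst of nat & int        (* Iconst i c  : X_i <- c *)
| Iadd of nat & nat & nat    (* Iadd i j k  : X_i <- X_j + X_k *)
| Isub of nat & nat & nat    (* Isub i j k  : X_i <- X_j - X_k *)
| Iload of nat & nat         (* Iload i j   : X_i <- X_{X_j} *)
| Istore of nat & nat        (* Istore i j  : X_{X_i} <- X_j *)
| Ijump of nat & nat         (* Ijump j l   : go to instruction l if X_j > 0 *)
| Iread of nat               (* Iread i     : X_i <- next input, 0 if none *)
| Iprint of nat              (* Iprint i    : append X_i to the output *).

Definition program := seq instr.

Record config := Config {
  pc : nat;
  mem : nat -> int;
  inp : seq int;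
  outp : seq int
}.

Definition upd (m : nat -> int) (i : nat) (z : int) : nat -> int :=
  fun j => if j == i then z else m j.

Definition exec (c : config) (i : instr) : option config :=
  let: Config q m s o := c in
  match i with
  | Iconst i z => Some (Config q.+1 (upd m i z) s o)
  | Iadd i j k => Some (Config q.+1 (upd m i (m j + m k)) s o)
  | Isub i j k => Some (Config q.+1 (upd m i (m j - m k)) s o)
  | Iload i j =>
      if m j is Posz a then Some (Config q.+1 (upd m i (m a)) s o) else None
  | Istore i j =>
      if m i is Posz a then Some (Config q.+1 (upd m a (m j)) s o) else None
  | Ijump j l => Some (Config (if 0 < m j then l else q.+1) m s o)
  | Iread i => Some (Config q.+1 (upd m i (head 0 s)) (behead s) o)
  | Iprint i => Some (Config q.+1 m s (rcons o (m i)))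
  end.

(* [None] means that the machine has halted: the program counter has left the
   program, or the next instruction has a negative indirect address. *)
Definition step (p : program) (c : config) : option config :=
  obind (exec c) (onth p (pc c)).

Definition init (input : seq int) : config := Config 0 (fun=> 0) input [::].

(* [runs_to p input t W output]: on the given input, p executes exactly t
   instructions, halts, and has printed the given output; moreover no register
   ever holds an integer of absolute value above W, so that the unit cost is
   that of operations on words of about log2 W bits. *)
Definition runs_to (p : program) (input : seq int) (t W : nat)
    (output : seq int) : Prop :=
  exists run : nat -> config,
    [/\ run 0%N = init input,
        forall s, (s < t)%N -> step p (run s) = Some (run s.+1),
        step p (run t) = None,
        outp (run t) = output
      & forall s a, (s <= t)%N -> (`|mem (run s) a| <= W)%N].

Section Encodings.
Variables (R : comPzRingType) (X : {fset R}).

(* The letters of Y and Y^-1 are the integers 1, ..., #|X| and their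
   opposites. *)
Definition letter_code (l : X * bool) : int :=
  let i := Posz (enum_rank l.1).+1 in if l.2 then i else - i.

Definition word_code (w : word X) : seq int := map letter_code w.

Definition input_code (u v : word X) : seq int :=
  word_code u ++ 0 :: word_code v ++ [:: 0].

(* (P, k) is written k, e, C_0, C_1, ..., C_(d-1), where C_j is the block of
   the #|X| coordinates, with respect to X, of the coefficient of t^(e + j) in
   P.  The code is not unique, since neither are the coordinates nor the window
   of exponents. *)
Definition is_code_of (s : seq int) (g : gamma2 R) : Prop :=
  exists (e : int) (cs : seq {ffun X -> int}),
    s = g.2 :: e :: flatten [seq [seq c x | x : X] | c : {ffun X -> int} <- cs]
    /\ g.1 = \sum_(j < size cs) << lincomb (nth [ffun=> 0] cs j) *g e + j%:Z >>.

Definition gamma2_conjugate (u v : gamma2 R) : Prop :=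
  exists g : gamma2 R, (g * u = v * g)%g.

Definition correct_answer (u v : gamma2 R) (out : seq int) : Prop :=
  (gamma2_conjugate u v ->
     exists g s, [/\ out = 1 :: s, is_code_of s g & (g * u = v * g)%g])
  /\ (~ gamma2_conjugate u v -> out = [:: 0]).

End Encodings.

(* Main.v *)
Require Import Defs.
From mathcomp Require Import all_boot all_algebra finmap.
From HB Require Import structures.
From mathcomp Require Import order zify ring boolp.
From mathcomp.multinomials Require Import monalg.

Set Implicit Arguments.
Unset Strict Implicit.
Unset Printing Implicit Defensive.

Import Order.TTheory GRing.Theory Num.Theory.

(** An equation (F, m) (P, k) = (Q, l) (F, m) means that k = l and that
    t^m P - Q = (t^k - 1) F. If k <> 0 such an F exists exactly when t^m P and
    Q agree modulo t^K - 1 with K = |k|, so that only m modulo K matters. If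
    k = 0 the requirement is t^m P = Q; it takes the same form as soon as K is
    larger than the spread of all exponents involved, because a polynomial
    that is divisible by t^K - 1 and supported in a shorter window is zero.
    With T the length of the input tape, K = 8 T is large enough. Hence in all
    cases some m with -2 T <= m < 2 T has to be found such that t^K - 1 divides
    t^m P - Q.

    Division by 1 - t^K replaces the coefficients of a polynomial by their
    prefix sums with stride K. The quotient is periodic to the right of the
    support, and it is a Laurent polynomial exactly when it vanishes on one
    period there ([diff_high], [shift_matches_conj], [conj_shift_matches]). The
    quotient of Q - t^m P is the difference of the quotient of Q and the shifted
    quotient of P. So prefix sums are computed once, and each of the O(n)
    shifts m is tested by comparing O(n) coefficients; for a successful m the
    same differences are the coefficients of F.

    Coefficients are stored as coordinate vectors with respect to X, and two
    vectors have to be recognized as the same element of R. The relations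
    among the elements of X have a triangular system of generators
    ([triangular_relations]), modulo which every vector is reduced to a normal
    form by repeated addition and subtraction; equal elements then have equal
    vectors ([normal_inj]). A letter of the input contributes at most once to
    a prefix sum, so the entries to be reduced are at most n, one vector takes
    O(n) steps, and the O(n) vectors take O(n^2).

    The program is written in a small structured language whose loops carry a
    bound, in T, on their number of iterations. Its semantics [wp] fails when
    such a bound is exceeded or when a value above W is written. Therefore
    [wp_sound], which transfers it to the machine, gives the bound W on the
    registers, and a running time that depends on the text of the program only
    ([time_order_main]). What remains is to execute the program symbolically,
    phase by phase ([wp_main]). *)

(** * A structured language over the machine *)

Inductive reg :=
| rZero | rOne | rT | rO | rK | rKu | rKv | rSg | rNeq | rFound | rRes | rPtr
| rCnt | rCur | rBase | rI | rJ | rM | rInner | rP | rQ | rA | rB | rX | rTmp.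

Definition rnum (r : reg) : nat :=
  match r with
  | rZero => 0 | rOne => 1 | rT => 2 | rO => 3 | rK => 4 | rKu => 5 | rKv => 6
  | rSg => 7 | rNeq => 8 | rFound => 9 | rRes => 10 | rPtr => 11 | rCnt => 12
  | rCur => 13 | rBase => 14 | rI => 15 | rJ => 16 | rM => 17 | rInner => 18
  | rP => 19 | rQ => 20 | rA => 21 | rB => 22 | rX => 23 | rTmp => 24
  end.

Definition nregs : nat := 25.

Lemma rnum_inj : injective rnum.
Proof.
pose rs := [:: rZero; rOne; rT; rO; rK; rKu; rKv; rSg; rNeq; rFound; rRes; rPtr;
  rCnt; rCur; rBase; rI; rJ; rM; rInner; rP; rQ; rA; rB; rX; rTmp].
by apply: (can_inj (g := nth rZero rs)); case.
Qed.

HB.instance Definition _ := Equality.copy reg (inj_type rnum_inj).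

Lemma rnum_lt r : rnum r < nregs.
Proof. by case: r. Qed.

Section Language.
Local Open Scope ring_scope.

(** The scalar variables occupy the first [nregs] registers of the machine and
    the heap all the others. With two separate components, a store to the heap
    is independent of the scalars by construction. *)
Record state := State {
  rg : reg -> int;
  hp : nat -> int;
  si : seq int;
  so : seq int
}.

Definition setr (s : state) (r : reg) (z : int) : state :=
  State (fun r' => if eqn (rnum r') (rnum r) then z else rg s r')
    (hp s) (si s) (so s).

Definition seth (s : state) (a : nat) (z : int) : state :=
  State (rg s) (upd (hp s) a z) (si s) (so s).

Definition pop (s : state) : state :=
  State (rg s) (hp s) (behead (si s)) (so s).

Definition emit (s : state) (z : int) : state :=
  State (rg s) (hp s) (si s) (rcons (so s) z).

(** The only jump of the machine is taken on positive values. Skipping a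
    command on a positive value and repeating it while a value is positive
    each need one such jump and no unconditional one. The function in [Repeat]
    bounds the number of iterations in terms of a parameter of the input; it
    leaves no trace in the compiled code. *)
Inductive cmd :=
| Skip
| Const of reg & int
| Plus of reg & reg & reg
| Minus of reg & reg & reg
| Get of reg & reg
| Put of reg & reg
| Read of reg
| Emit of reg
| Seq of cmd & cmd
| Unless of reg & cmd
| Repeat of (nat -> nat) & reg & cmd.

Fixpoint compile (o : nat) (c : cmd) : program :=
  match c with
  | Skip => [::]
  | Const r z => [:: Iconst (rnum r) z]
  | Plus r a b => [:: Iadd (rnum r) (rnum a) (rnum b)]
  | Minus r a b => [:: Isub (rnum r) (rnum a) (rnum b)]
  | Get r p => [:: Iload (rnum r) (rnum p)]
  | Put p r => [:: Istore (rnum p) (rnum r)]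
  | Read r => [:: Iread (rnum r)]
  | Emit r => [:: Iprint (rnum r)]
  | Seq c1 c2 => compile o c1 ++ compile (o + size (compile o c1)) c2
  | Unless r c =>
      Ijump (rnum r) (o.+1 + size (compile o.+1 c)) :: compile o.+1 c
  | Repeat _ r c => rcons (compile o c) (Ijump (rnum r) o)
  end.

Fixpoint cost (c : cmd) (T : nat) : nat :=
  match c with
  | Skip => 0
  | Seq c1 c2 => cost c1 T + cost c2 T
  | Unless _ c => (cost c T).+1
  | Repeat B _ c => B T * (cost c T).+1
  | _ => 1
  end%N.

Section Wp.
Variables T W : nat.

Definition fits (z : int) : Prop := (`|z| <= W)%N.

(** The failures carry the resource bounds: [wp] is false for a write of a value
    outside [-W, W], for an indirect access below the heap, and for a loop that
    exceeds its number of iterations. *)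
Fixpoint wp (c : cmd) (Q : state -> Prop) (s : state) {struct c} : Prop :=
  match c with
  | Skip => Q s
  | Const r z => fits z /\ Q (setr s r z)
  | Plus r a b => fits (rg s a + rg s b) /\ Q (setr s r (rg s a + rg s b))
  | Minus r a b => fits (rg s a - rg s b) /\ Q (setr s r (rg s a - rg s b))
  | Get r p => nregs%:Z <= rg s p /\ Q (setr s r (hp s `|rg s p|%N))
  | Put p r => nregs%:Z <= rg s p /\ Q (seth s `|rg s p|%N (rg s r))
  | Read r => fits (head 0 (si s)) /\ Q (setr (pop s) r (head 0 (si s)))
  | Emit r => Q (emit s (rg s r))
  | Seq c1 c2 => wp c1 (wp c2 Q) s
  | Unless r c => if 0 < rg s r then Q s else wp c Q s
  | Repeat B r c =>
      iter (B T) (fun again => wp c (fun s' => if 0 < rg s' r then again s' else Q s'))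
        (fun _ => False) s
  end.

Lemma wp_seq c1 c2 Q s : wp (Seq c1 c2) Q s = wp c1 (wp c2 Q) s.
Proof. by []. Qed.

Lemma wp_mono c (Q Q' : state -> Prop) s :
  (forall s', Q s' -> Q' s') -> wp c Q s -> wp c Q' s.
Proof.
elim: c Q Q' s => [|r z|r a b|r a b|r p|p r|r|r|c1 IH1 c2 IH2|r c IH|B r c IH]
  Q Q' s QQ' //=; try by case=> ? ?; split=> //; apply: QQ'.
- exact: QQ'.
- exact: QQ'.
- by apply: IH1 => s'; apply: IH2.
- by case: ifP => _; [apply: QQ' | apply: IH].
- elim: (B T) s => //= n IHn s; apply: IH => s'.
  by case: ifP => _; [apply: IHn | apply: QQ'].
Qed.

(** The invariant I n says in particular that at most n iterations remain. *)
Lemma wp_repeat (I : nat -> state -> Prop) B r c (Q : state -> Prop) s :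
  (forall n s', I n.+1 s' ->
     wp c (fun s'' => if 0 < rg s'' r then I n s'' else Q s'') s') ->
  (forall s', ~ I 0%N s') -> I (B T) s -> wp (Repeat B r c) Q s.
Proof.
move=> step I0 /=; elim: (B T) s => [|n IHn] s /=; first exact: I0.
move=> Is; apply: wp_mono (step _ _ Is) => s'.
by case: ifP => // _; apply: IHn.
Qed.

Section Machine.
Variable p : program.

Definition bounded (c : config) : Prop := forall a, fits (Defs.mem c a).

Inductive reach : config -> nat -> config -> Prop :=
| Reach0 c : bounded c -> reach c 0 c
| ReachS c c1 k c' :
    bounded c -> step p c = Some c1 -> reach c1 k c' -> reach c k.+1 c'.

Lemma reach_trans c1 k1 c2 k2 c3 :
  reach c1 k1 c2 -> reach c2 k2 c3 -> reach c1 (k1 + k2) c3.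
Proof.
by elim=> // c c1' k c' bc st _ IH r; rewrite addSn; apply: ReachS bc st (IH r).
Qed.

Definition repr (m : nat -> int) (s : state) : Prop :=
  [/\ forall r, m (rnum r) = rg s r,
      forall a, (nregs <= a)%N -> m a = hp s a & forall a, fits (m a)].

Lemma repr_setr m s r z :
  repr m s -> fits z -> repr (upd m (rnum r) z) (setr s r z).
Proof.
case=> mr mh mb bz; split=> [r'|a ha|a]; rewrite /upd.
- by rewrite /= eqnE; case: ifP => // _; apply: mr.
- by rewrite gtn_eqF ?mh //; apply: leq_trans ha; apply: rnum_lt.
- by case: ifP.
Qed.

Lemma repr_seth m s a z :
  repr m s -> (nregs <= a)%N -> fits z -> repr (upd m a z) (seth s a z).
Proof.
case=> mr mh mb ha bz; split=> [r|b hb|b]; rewrite /upd /=.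
- by rewrite ltn_eqF ?mr //; apply: leq_trans ha; apply: rnum_lt.
- by rewrite mh.
- by case: ifP.
Qed.

Definition at_pc (o : nat) (m : nat -> int) (s : state) : config :=
  Config o m (si s) (so s).

Definition code_at (o : nat) (l : program) : Prop :=
  forall i, (i < size l)%N -> onth p (o + i) = onth l i.

Lemma code_at_cat o l1 l2 :
  code_at o (l1 ++ l2) -> code_at o l1 /\ code_at (o + size l1) l2.
Proof.
move=> h; split=> i hi.
  by rewrite h ?size_cat ?ltn_addr // onth_cat hi.
rewrite -addnA h ?size_cat ?ltn_add2l // onth_cat ltnNge leq_addr /=.
by rewrite addKn.
Qed.

Lemma code_at_head o i l : code_at o (i :: l) -> onth p o = Some i.
Proof. by move=> /(_ 0%N isT); rewrite addn0. Qed.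

Lemma reach_basic o i m s m' s' :
  onth p o = Some i -> bounded (at_pc o m s) ->
  exec (at_pc o m s) i = Some (at_pc o.+1 m' s') -> bounded (at_pc o.+1 m' s') ->
  reach (at_pc o m s) 1 (at_pc o.+1 m' s').
Proof.
move=> hi b0 ex b1; apply: ReachS b0 _ (Reach0 b1).
have -> : step p (at_pc o m s) = exec (at_pc o m s) i by rewrite /step hi.
exact: ex.
Qed.

(** The number of instructions can be bounded without looking at the state,
    since [wp] has already forced every loop to respect its own bound. *)
Lemma wp_sound c Q o m s :
  code_at o (compile o c) -> repr m s -> wp c Q s ->
  exists k s' m', [/\ (k <= cost c T)%N, Q s', repr m' s' &
    reach (at_pc o m s) k (at_pc (o + size (compile o c)) m' s')].
Proof.
have basic i m1 s1 m2 s2 o1 : onth p o1 = Some i -> repr m1 s1 ->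
    exec (at_pc o1 m1 s1) i = Some (at_pc o1.+1 m2 s2) -> repr m2 s2 ->
    reach (at_pc o1 m1 s1) 1 (at_pc (o1 + 1) m2 s2).
  by move=> hi [_ _ b1] ex [_ _ b2]; rewrite addn1; apply: reach_basic hi _ ex _.
elim: c Q o m s => [|r z|r a b|r a b|r a|a r|r|r|c1 IH1 c2 IH2|r c IH|B r c IH]
  Q o m s /= co rm.
- move=> Qs; exists 0%N, s, m; rewrite addn0; split=> //.
  by apply: Reach0; case: rm.
- move=> [bz Qs]; have rm' := repr_setr r rm bz.
  exists 1%N, (setr s r z), (upd m (rnum r) z); split=> //.
  by apply: basic (code_at_head co) rm _ rm'.
- move=> [bz Qs]; have rm' := repr_setr r rm bz.
  exists 1%N, (setr s r (rg s a + rg s b)), (upd m (rnum r) (rg s a + rg s b)).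
  split=> //; have [mr _ _] := rm.
  by apply: (basic _ _ _ _ _ _ (code_at_head co) rm _ rm'); rewrite /= !mr.
- move=> [bz Qs]; have rm' := repr_setr r rm bz.
  exists 1%N, (setr s r (rg s a - rg s b)), (upd m (rnum r) (rg s a - rg s b)).
  split=> //; have [mr _ _] := rm.
  by apply: (basic _ _ _ _ _ _ (code_at_head co) rm _ rm'); rewrite /= !mr.
- move=> [ha Qs]; case: (rm) => mr mh mb.
  have ha' : (nregs <= `|rg s a|)%N by lia.
  have bz : fits (hp s `|rg s a|%N) by rewrite -mh.
  have rm' := repr_setr r rm bz.
  exists 1%N, (setr s r (hp s `|rg s a|%N)), (upd m (rnum r) (hp s `|rg s a|%N)).
  split=> //; apply: (basic _ _ _ _ _ _ (code_at_head co) rm _ rm').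
  by rewrite /= mr; case: (rg s a) ha ha' mh => //= n _ hn ->.
- move=> [ha Qs]; case: (rm) => mr mh mb.
  have ha' : (nregs <= `|rg s a|)%N by lia.
  have bz : fits (rg s r) by rewrite -mr.
  have rm' := repr_seth rm ha' bz.
  exists 1%N, (seth s `|rg s a|%N (rg s r)), (upd m `|rg s a|%N (rg s r)).
  split=> //; apply: (basic _ _ _ _ _ _ (code_at_head co) rm _ rm').
  by rewrite /= !mr; case: (rg s a) ha => //= n _.
- move=> [bz Qs]; set s1 := pop s in Qs.
  have rm1 : repr m s1 by case: rm.
  have rm' := repr_setr r rm1 bz.
  exists 1%N, (setr s1 r (head 0 (si s))), (upd m (rnum r) (head 0 (si s))).
  by split=> //; apply: basic (code_at_head co) rm _ rm'.
- move=> Qs; set s1 := emit _ _ in Qs.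
  have rm1 : repr m s1 by case: rm.
  exists 1%N, s1, m; split=> //; have [mr _ _] := rm.
  by apply: (basic _ _ _ _ _ _ (code_at_head co) rm _ rm1); rewrite /= mr.
- case/code_at_cat: co => co1 co2 /(IH1 _ _ _ _ co1 rm).
  case=> [k1 [s1 [m1 [hk1 Q1 rm1 r1]]]].
  have [k2 [s2 [m2 [hk2 Q2 rm2 r2]]]] := IH2 _ _ _ _ co2 rm1 Q1.
  exists (k1 + k2)%N, s2, m2; split=> //; first exact: leq_add.
  by rewrite size_cat addnA; apply: reach_trans r1 r2.
- have hd := code_at_head co.
  have co' : code_at o.+1 (compile o.+1 c).
    by move: co; rewrite -cat1s => /code_at_cat[_]; rewrite addn1.
  case: (rm) => mr _ mb; case: ifP => [pos Qs|npos].
    exists 1%N, s, m; split=> //; apply: ReachS (Reach0 _) => //.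
    by rewrite /step /= hd /= mr pos addSnnS.
  move=> /(IH _ _ _ _ co' rm)[k [s1 [m1 [hk Q1 rm1 r1]]]].
  exists k.+1, s1, m1; split=> //; rewrite -addSnnS; apply: ReachS r1 => //.
  by rewrite /step /= hd /= mr npos.
- move: co; rewrite -cats1 => /code_at_cat[co /code_at_head hd].
  elim: (B T) m s rm => //= n IHn m s rm.
  move=> /(IH _ _ _ _ co rm)[k [s1 [m1 [hk Q1 rm1 r1]]]].
  case: (rm1) => mr1 _ mb1; move: Q1; case: ifP => [pos|npos] Q1.
    have [k2 [s2 [m2 [hk2 Q2 rm2 r2]]]] := IHn _ _ rm1 Q1.
    exists (k + k2.+1)%N, s2, m2; split=> //.
      by rewrite mulSn addSnnS leq_add.
    apply: reach_trans r1 _; apply: ReachS r2 => //.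
    by rewrite /step /= hd /= mr1 pos.
  exists (k + 1)%N, s1, m1; split=> //.
    by rewrite mulSn addn1 ltnS (leq_trans hk) ?leq_addr.
  apply: reach_trans r1 _; rewrite size_cat addn1 addnS; apply: ReachS (Reach0 _) => //.
  by rewrite /step /= hd /= mr1 npos.
Qed.

End Machine.

Definition blank (input : seq int) : state :=
  State (fun=> 0) (fun=> 0) input [::].

Lemma wp_runs_to c input (Q : seq int -> Prop) :
  wp c (fun s => Q (so s)) (blank input) ->
  exists t out, [/\ (t <= cost c T)%N, runs_to (compile 0 c) input t W out & Q out].
Proof.
set p := compile 0 c => wpc.
have co : code_at p 0 p by [].
have rm : repr (fun=> 0) (blank input) by [].
have [k [s [m [hk Qs rs r]]]] := wp_sound co rm wpc.
exists k, (so s); split=> //; rewrite add0n in r.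
pose run i := iter i (fun c => odflt c (step p c)) (init input).
have [hlt hend bd] : [/\ forall i, (i < k)%N -> step p (run i) = Some (run i.+1),
    run k = at_pc (size p) m s & forall i, (i <= k)%N -> bounded (run i)].
  have -> : run = fun i => iter i (fun c => odflt c (step p c))
      (at_pc 0 (fun=> 0) (blank input)) by [].
  elim: {Qs wpc hk rm run} r => [c0 b0|c0 c1 j c' b0 st _ [IH1 IH2 IH3]].
    by split=> // i; rewrite leqn0 => /eqP ->.
  have it i : iter i.+1 (fun c => odflt c (step p c)) c0 =
      iter i (fun c => odflt c (step p c)) c1 by rewrite iterSr st.
  split=> [[|i] hi|| [|i] hi] //; last 2 first.
  - by rewrite it.
  - by rewrite it; apply: IH3.
  - by rewrite /= st.
  - by rewrite !it; apply: IH1.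
exists run; rewrite hend; split=> //.
  by rewrite /step /= onth_default.
by move=> i a /bd /(_ a).
Qed.

End Wp.
End Language.

(** * Derived commands and their rules *)

(** The loop is unrolled: n is a constant of the program. *)
Fixpoint For (n : nat) (f : nat -> cmd) : cmd :=
  if n is n'.+1 then Seq (For n' f) (f n') else Skip.

Definition IfPos r c := Seq (Minus rTmp rOne r) (Unless rTmp c).
Definition IfNeg r c := Seq (Plus rTmp rOne r) (Unless rTmp c).
Definition Move r a := Plus r a rZero.
Definition Incr r := Plus r r rOne.
Definition Decr r := Minus r r rOne.

Declare Scope cmd_scope.
Delimit Scope cmd_scope with cmd.
Notation "c1 ;; c2" := (Seq c1 c2) (at level 100, right associativity) : cmd_scope.


(** The machine has no multiplication, so the offset S * i takes S additions. *)
Definition address (S : nat) (p base i : reg) : cmd :=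
  (Move p base;; For S (fun=> Plus p p i))%cmd.

Section Rules.
Local Open Scope ring_scope.
Variables T W : nat.
Notation wp := (wp T W).
Notation bnd := (fits W).

Lemma wp_For (I : nat -> state -> Prop) n f (Q : state -> Prop) s :
  I 0%N s -> (forall j s', (j < n)%N -> I j s' -> wp (f j) (I j.+1) s') ->
  (forall s', I n s' -> Q s') -> wp (For n f) Q s.
Proof.
elim: n Q s => [|n IH] Q s I0 step IQ /=; first exact: IQ.
apply: IH => // [j s' jn|s' In]; first by apply: step; apply: ltnW.
by apply: wp_mono (step _ _ (ltnSn n) In).
Qed.

Lemma setr_setr s r z z' : setr (setr s r z) r z' = setr s r z'.
Proof.
by rewrite /setr /=; congr State; apply: funext => r'; case: eqn.
Qed.

Lemma rg_setr_neq s r z r' : ~~ eqn (rnum r') (rnum r) -> rg (setr s r z) r' = rg s r'.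
Proof. by move=> /= /negPf ->. Qed.

Lemma wp_ifpos r c (Q : state -> Prop) s :
  rg s rOne = 1 -> bnd (1 - rg s r) ->
  (0 < rg s r -> wp c Q (setr s rTmp (1 - rg s r))) ->
  (rg s r <= 0 -> Q (setr s rTmp (1 - rg s r))) -> wp (IfPos r c) Q s.
Proof.
move=> h1 hb hp hn; rewrite /IfPos /= h1; split=> //.
by case: ifP => h; [apply: hn | apply: hp]; lia.
Qed.

Lemma wp_ifneg r c (Q : state -> Prop) s :
  rg s rOne = 1 -> bnd (1 + rg s r) ->
  (rg s r < 0 -> wp c Q (setr s rTmp (1 + rg s r))) ->
  (0 <= rg s r -> Q (setr s rTmp (1 + rg s r))) -> wp (IfNeg r c) Q s.
Proof.
move=> h1 hb hp hn; rewrite /IfNeg /= h1; split=> //.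
by case: ifP => h; [apply: hn | apply: hp]; lia.
Qed.

Lemma wp_address S p base i (Q : state -> Prop) s :
  ~~ eqn (rnum i) (rnum p) -> rg s rZero = 0 ->
  `|rg s base| + S%:Z * `|rg s i| <= W%:Z ->
  Q (setr s p (rg s base + S%:Z * rg s i)) ->
  wp (address S p base i) Q s.
Proof.
move=> ip h0 hW HQ; rewrite /address; move: S hW HQ => n hW HQ /=.
split; first by rewrite h0 /fits; nia.
rewrite h0 addr0.
pose I (j : nat) s' := s' = setr s p (rg s base + j%:Z * rg s i).
apply: (wp_For (I := I)) => [|j s' jn ->|s' ->] //.
  by rewrite /I mul0r addr0.
rewrite /I /=; move: ip => /negPf ip; rewrite ip eqnE eqxx setr_setr.
split; last by congr setr; rewrite -addn1 PoszD mulrDl mul1r addrA.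
have : (j.+1)%:Z * `|rg s i| <= n%:Z * `|rg s i|.
  by apply: ler_wpM2r; [exact: normr_ge0 | rewrite lez_nat].
rewrite /fits -addn1 PoszD; case: (leP 0 (rg s i)) => hi; lia.
Qed.

Definition changes_only (l : seq reg) (s s' : state) : Prop :=
  forall r, r \notin l -> rg s' r = rg s r.

Lemma changes_only_refl l s : changes_only l s s.
Proof. by []. Qed.

Lemma changes_only_setr l s s' r z :
  r \in l -> changes_only l s s' -> changes_only l s (setr s' r z).
Proof.
move=> rl h r' r'l; rewrite rg_setr_neq; first exact: h.
by rewrite eqnE; apply: contraNN r'l => /eqP/rnum_inj ->.
Qed.

Lemma changes_only_seth l s s' a z : changes_only l s s' -> changes_only l s (seth s' a z).
Proof. by []. Qed.

Lemma changes_only_pop l s s' : changes_only l s s' -> changes_only l s (pop s').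
Proof. by []. Qed.

Lemma changes_only_emit l s s' z : changes_only l s s' -> changes_only l s (emit s' z).
Proof. by []. Qed.

Lemma changes_only_trans l s1 s2 s3 :
  changes_only l s1 s2 -> changes_only l s2 s3 -> changes_only l s1 s3.
Proof. by move=> h1 h2 r hr; rewrite h2 ?h1. Qed.

Lemma changes_only_sub l l' s s' : {subset l <= l'} -> changes_only l s s' -> changes_only l' s s'.
Proof. by move=> sub h r hr; apply: h; apply: contraNN hr => /sub. Qed.

End Rules.

Ltac track_changes := repeat lazymatch goal with
  | |- changes_only _ _ (setr _ _ _) => apply: changes_only_setr; [by [] |]
  | |- changes_only _ _ (seth _ _ _) => apply: changes_only_seth
  | |- changes_only _ _ (pop _) => apply: changes_only_pop
  | |- changes_only _ _ (emit _ _) => apply: changes_only_emit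
  end; try first [assumption | exact: changes_only_refl].

Ltac bounds := rewrite /fits /=; lia.

(* Symbolic execution by simplification has to stop at these commands, for
   which the rules above are used. *)
#[global] Opaque IfPos IfNeg address.

(** * Normal forms of coordinate vectors *)

Section TriangularRelations.
Local Open Scope ring_scope.

Variable Ker : (nat -> int) -> Prop.
Hypothesis Ker0 : Ker (fun=> 0).
Hypothesis KerB : forall c c' z, Ker c -> Ker c' -> Ker (fun j => c j - z * c' j).

(** The i-th entries of the relations that vanish before i form a subgroup of
    the integers, and d i is its nonnegative generator. *)
Lemma triangular_relations :
  exists (d : nat -> nat) (b : nat -> nat -> int), forall i,
    [/\ Ker (b i), forall j, (j < i)%N -> b i j = 0, b i i = d i &
        forall c, Ker c -> (forall j, (j < i)%N -> c j = 0) -> (d i %| c i)%Z].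
Proof.
pose P i (db : nat * (nat -> int)) := [/\ Ker db.2,
  forall j, (j < i)%N -> db.2 j = 0, db.2 i = db.1 &
  forall c, Ker c -> (forall j, (j < i)%N -> c j = 0) -> (db.1 %| c i)%Z].
suff /choice[f fP] : forall i, exists db, P i db.
  by exists (fun i => (f i).1), (fun i => (f i).2) => i; apply: fP.
move=> i.
pose pivot n := `[< (0 < n)%N /\ exists c, [/\ Ker c,
  forall j, (j < i)%N -> c j = 0 & c i = n%:Z] >].
have [ex|nex] := pselect (exists n, pivot n).
  case: (ex_minnP ex) => d /asboolP[d0 [b [Kb b0 bi]]] dmin.
  exists (d, b); split=> //= c Kc c0.
  pose r := (c i %% d)%Z; have dz : d%:Z != 0 by lia.
  have r0 := modz_ge0 (c i) dz; have rd := ltz_mod (c i) dz.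
  apply/dvdz_mod0P; apply/eqP; apply: contraT => rn0.
  suff : pivot `|(c i %% d)%Z|%N by move/dmin; lia.
  apply/asboolP; split; first by lia.
  exists (fun j => c j - (c i %/ d)%Z * b j); split; first exact: KerB.
    by move=> j ji; rewrite c0 // b0 // mulr0 subrr.
  by rewrite bi {1}(divz_eq (c i) d) addrC addKr; lia.
exists (0%N, fun=> 0); split=> //= c Kc c0.
rewrite dvd0z; apply: contraT => cn0; case: nex; exists `|c i|%N; apply/asboolP.
split; first by lia.
case: (leP 0 (c i)) => ci; first by exists c; split=> //; lia.
exists (fun j => 0 - 1 * c j); split; first exact: KerB.
  by move=> j ji; rewrite c0 //; lia.
by lia.
Qed.

Variables (N : nat) (d : nat -> nat) (b : nat -> nat -> int).

Definition normal (c : nat -> int) : Prop :=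
  forall i, (i < N)%N -> (0 < d i)%N -> 0 <= c i < (d i)%:Z.

(** At the first index where two congruent normal vectors differ, d i divides
    the difference of the entries; this difference is smaller than d i if
    d i > 0, and a multiple of 0 otherwise. *)
Lemma normal_inj c c' :
  (forall i c, Ker c -> (forall j, (j < i)%N -> c j = 0) -> (d i %| c i)%Z) ->
  normal c -> normal c' -> Ker (fun j => c j - 1 * c' j) ->
  forall i, (i < N)%N -> c i = c' i.
Proof.
move=> dP nc nc' K i; elim/ltn_ind: i => i IH iN.
have /dvdzP[q] : (d i %| c i - 1 * c' i)%Z.
  by apply: (dP _ _ K) => j ji; have := IH j ji (ltn_trans ji iN); lia.
have [d0|d0] := posnP (d i); first by rewrite d0; lia.
have := nc i iN d0; have := nc' i iN d0 => h1 h2 e.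
have : q = 0 by nia.
by move=> q0; move: e; rewrite q0; lia.
Qed.

End TriangularRelations.

(** * Words and their coefficients *)

Section Words.
Local Open Scope ring_scope.
Variables (R : comPzRingType) (X : {fset R}).

Definition lin (c : nat -> int) : R := lincomb [ffun x : X => c (enum_rank x)].

Lemma linE c : lin c = \sum_(x : X) val x *~ c (enum_rank x).
Proof. by apply: eq_bigr => x _; rewrite ffunE. Qed.

Lemma eq_lin c c' : (forall y, (y < #|{: X}|)%N -> c y = c' y) -> lin c = lin c'.
Proof. by move=> e; rewrite !linE; apply: eq_bigr => x _; rewrite e. Qed.

Lemma lin0 : lin (fun=> 0) = 0.
Proof. by rewrite linE big1. Qed.

Lemma linD c c' : lin (fun y => c y + c' y) = lin c + lin c'.
Proof. by rewrite !linE -big_split; apply: eq_bigr => x _; rewrite mulrzDr. Qed.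

Lemma linM c z : lin (fun y => z * c y) = lin c *~ z.
Proof.
by rewrite !linE mulrz_suml; apply: eq_bigr => x _; rewrite mulrC mulrzA.
Qed.

Lemma linBM c c' z : lin (fun y => c y - z * c' y) = lin c - lin c' *~ z.
Proof.
rewrite -mulrNz -linM -linD; apply: eq_lin => y _; lia.
Qed.

Lemma linB c c' : lin (fun y => c y - c' y) = lin c - lin c'.
Proof. by rewrite -[lin c' in RHS]mulr1z -linBM; apply: eq_lin => y _; lia. Qed.

Lemma lin_delta (x : X) z :
  lin (fun y => if y == enum_rank x then z else 0) = val x *~ z.
Proof.
rewrite linE (bigD1 x) //= eqxx big1 ?addr0 // => x' x'x.
by rewrite val_eqE (inj_eq enum_rank_inj) (negPf x'x).
Qed.

(** A letter contributes one monomial to the polynomial of its word, and the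
    mark (e, y, s) stands for s x_y t^e. *)
Definition mark := (int * nat * int)%type.

Definition expo (w : word X) : int := \sum_(l <- w) (if l.2 then 1 else - 1).

(** The factor sg is the sign of the exponent of t in the word: for a negative
    one both polynomials are negated, see [shift_matches_conj]. *)
Fixpoint marks (sg c : int) (w : word X) : seq mark :=
  match w with
  | [::] => [::]
  | (x, true) :: w' => (c, enum_rank x : nat, sg) :: marks sg (c + 1) w'
  | (x, false) :: w' => (c - 1, enum_rank x : nat, - sg) :: marks sg (c - 1) w'
  end.

Definition coef (ms : seq mark) (i : int) (y : nat) : int :=
  \sum_(m <- ms) (if (m.1.1 == i) && (m.1.2 == y) then m.2 else 0).

(** The y-th coordinate of the coefficient of t^i after division by 1 - t^K. *)
Definition wsum (K : int) (ms : seq mark) (i : int) (y : nat) : int :=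
  \sum_(m <- ms)
    (if [&& m.1.1 <= i, (K %| i - m.1.1)%Z & m.1.2 == y] then m.2 else 0).

Lemma coef_cons m ms i y :
  coef (m :: ms) i y = (if (m.1.1 == i) && (m.1.2 == y) then m.2 else 0) + coef ms i y.
Proof. by rewrite /coef big_cons. Qed.

Lemma wsum_rec (K : int) ms i y : 0 < K -> wsum K ms i y = coef ms i y + wsum K ms (i - K) y.
Proof.
move=> K0; rewrite /wsum /coef -big_split /=; apply: eq_bigr => -[[e y'] s] _ /=.
case: (y' == y); rewrite ?andbF ?andbT ?addr0 //.
have -> : i - K - e = (i - e) - K by ring.
rewrite [(K %| _ - K)%Z]rpredBr ?dvdzz //.
have [dv|ndv] := boolP (K %| i - e)%Z; rewrite ?andbF ?andbT; last first.
  have -> : (e == i) = false.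
    by apply: contraNF ndv => /eqP ->; rewrite subrr dvdz0.
  by rewrite ?addr0.
have [q eq] : exists q : int, i - e = q * K by apply/dvdzP.
have [q0|q0|q0] := ltgtP q 0.
- have qK : q * K <= - K by nia.
  have -> : (e <= i) = false by lia.
  have -> : (e == i) = false by lia.
  by have -> : (e <= i - K) = false by lia.
- have qK : K <= q * K by nia.
  have -> : (e <= i) = true by lia.
  have -> : (e == i) = false by lia.
  have -> : (e <= i - K) = true by lia.
  by rewrite add0r.
- rewrite q0 mul0r in eq.
  have -> : (e <= i) = true by lia.
  have -> : (e == i) = true by lia.
  have -> : (e <= i - K) = false by lia.
  by rewrite addr0.
Qed.

Lemma size_marks sg c w : size (marks sg c w) = size w.
Proof. by elim: w c => //= -[x []] w IH c /=; rewrite IH. Qed.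

Lemma marksP sg c w m : m \in marks sg c w ->
  c - (size w)%:Z <= m.1.1 <= c + (size w)%:Z /\ (m.2 = sg \/ m.2 = - sg).
Proof.
elim: w c => //= -[x []] w IH c; rewrite inE => /orP[/eqP->|/IH[h s]] /=;
  by split=> //; try (by left); try (by right); lia.
Qed.

Lemma expo_cons x (b : bool) w : expo ((x, b) :: w) = (if b then 1 else - 1) + expo w.
Proof. by rewrite /expo big_cons. Qed.

Lemma expo_bound w : - (size w)%:Z <= expo w <= (size w)%:Z.
Proof.
elim: w => [|[x b] w IH]; first by rewrite /expo big_nil.
rewrite expo_cons /=; case: b; lia.
Qed.

Lemma wsum_out (K sg : int) w (i : int) y : i < - (size w)%:Z -> wsum K (marks sg 0 w) i y = 0.
Proof.
move=> hi; rewrite /wsum big_seq big1 // => m /marksP[h _].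
by have -> : (m.1.1 <= i) = false by lia.
Qed.

(** The length of the word bounds any partial sum over its marks, in particular
    a prefix sum, whereas adding up bounds on single coefficients would give a
    quadratic estimate. *)
Lemma marks_sum_bound (p : pred mark) (sg c : int) w : `|sg| <= 1 ->
  `|\sum_(m <- marks sg c w) (if p m then m.2 else 0)| <= (size w)%:Z.
Proof.
move=> hs; rewrite -(size_marks sg c w).
have : all (fun m : mark => `|m.2| <= 1) (marks sg c w).
  by apply/allP => m /marksP[_ [->|->]]; rewrite ?normrN.
elim: (marks sg c w) => [_|m ms IH /= /andP[hm /IH]]; first by rewrite big_nil.
rewrite big_cons => h; apply: le_trans (ler_normD _ _) _; rewrite -add1n PoszD lerD //.
by case: ifP; rewrite ?normr0.
Qed.

Lemma wsum_bound (K sg c : int) w (i : int) y : `|sg| <= 1 ->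
  `|wsum K (marks sg c w) i y| <= (size w)%:Z.
Proof. exact: marks_sum_bound. Qed.

Lemma coef_bound (sg c : int) w (i : int) y : `|sg| <= 1 ->
  `|coef (marks sg c w) i y| <= (size w)%:Z.
Proof. exact: marks_sum_bound. Qed.

Lemma coef_out sg w (i : int) y : (i < - (size w)%:Z) || ((size w)%:Z < i) ->
  coef (marks sg 0 w) i y = 0.
Proof.
move=> hi; rewrite /coef big_seq big1 // => m /marksP[h _].
by have -> : (m.1.1 == i) = false by lia.
Qed.

Lemma word_value_cons l (w : word X) :
  word_value (l :: w) = (letter_value l * word_value w)%g.
Proof. by rewrite /word_value big_cons. Qed.

Lemma word_value2 (w : word X) : (word_value w).2 = expo w.
Proof.
elim: w => [|[x b] w IH]; first by rewrite /word_value /expo !big_nil.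
by rewrite word_value_cons expo_cons /= IH; case: b.
Qed.

Lemma lin_coef sg c w i :
  lin (coef (marks sg c w) i) = ((word_value w).1)@_(i - c) *~ sg.
Proof.
elim: w c => [|[x b] w IH] c.
  rewrite /word_value big_nil mcoeff0 mul0rz -lin0.
  by apply: eq_lin => y _; rewrite /coef big_nil.
rewrite word_value_cons /=.
case: b => /=.
  under [X in lin X]funext => y do rewrite coef_cons /=.
  rewrite linD IH mcoeffD coef_tmul mcoeffU mulrzDl.
  have -> : i - (c + 1) = i - c - 1 by ring.
  congr (_ + _).
  have -> : (0 == i - c) = (c == i) by lia.
  case: eqP => _ /=; last by rewrite lin0 mul0rz.
  under [X in lin X]funext => y do rewrite eq_sym.
  by rewrite lin_delta.
under [X in lin X]funext => y do rewrite coef_cons /=.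
rewrite linD IH mcoeffD coef_tmul mcoeffN coef_tmul mcoeffU mulrzDl.
have -> : i - (c - 1) = i - c - - 1 by ring.
congr (_ + _).
have -> : (0 == i - c - - 1) = (c - 1 == i) by lia.
case: eqP => _ /=; last by rewrite lin0 oppr0 mul0rz.
under [X in lin X]funext => y do rewrite eq_sym.
by rewrite lin_delta mulrNz mulNrz.
Qed.

Lemma expo_rcons (w : word X) x (b : bool) :
  expo (rcons w (x, b)) = expo w + if b then 1 else - 1.
Proof. by rewrite /expo -cats1 big_cat big_seq1. Qed.

Lemma marks_rcons sg c (w : word X) x b :
  marks sg c (rcons w (x, b)) = rcons (marks sg c w)
    (if b then (c + expo w, enum_rank x : nat, sg)
     else (c + expo w - 1, enum_rank x : nat, - sg)).
Proof.
elim: w c => [|[x' b'] w IH] c /=.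
  by rewrite /expo big_nil addr0; case: b.
by rewrite expo_cons; case: b'; rewrite IH addrA.
Qed.

Lemma coef_rcons ms m i y : coef (rcons ms m) i y =
  coef ms i y + (if (m.1.1 == i) && (m.1.2 == y) then m.2 else 0).
Proof. by rewrite /coef -cats1 big_cat big_seq1. Qed.

Lemma coef_large sg c (w : word X) i y : (#|{: X}| <= y)%N -> coef (marks sg c w) i y = 0.
Proof.
move=> hy; rewrite /coef big_seq big1 // => m.
elim: w c => //= -[x b] w IH c.
have ne z : (z == i) && (enum_rank x == y :> nat) = false.
  by rewrite (@ltn_eqF (enum_rank x) y) ?andbF //; apply: leq_trans hy.
by case: b; rewrite inE => /orP[/eqP->|/IH //] /=; rewrite ne.
Qed.

End Words.

(** * The conjugacy criterion *)

(** When f and h are the prefix sums of P and Q, this is the expansion of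
    (Q - t^m P) / (1 - t^K), the only candidate for the polynomial part of a
    conjugator. *)
Definition shifted_diff (R : comPzRingType) (f h : int -> R) (m i : int) : R :=
  (h i - f (i - m))%R.

Section Conjugacy.
Local Open Scope ring_scope.
Variables (R : comPzRingType).
Implicit Types (P Q F : laurent R) (f r : int -> R).

Lemma conj_coefP F P Q (m k l : int) :
  (((F, m) : gamma2 R) * ((P, k) : gamma2 R) = ((Q, l) : gamma2 R) * ((F, m) : gamma2 R))%g <->
  k = l /\ forall i, F@_i + P@_(i - m) = Q@_i + F@_(i - k).
Proof.
split=> [e|[<- h]].
  have eFP : F + tmul m P = Q + tmul l F := congr1 fst e.
  have ekl : m + k = l + m := congr1 snd e.
  have kl : k = l by lia.
  split=> // i; move: (congr1 (mcoeff i) eFP).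
  by rewrite /= !mcoeffD !coef_tmul kl.
have e : F + tmul m P = Q + tmul k F.
  by apply/malgP => i; rewrite !mcoeffD !coef_tmul.
exact: (congr2 pair e (addrC m k)).
Qed.

Lemma int_above_ind (lo K : int) (C : int -> Prop) : 0 < K ->
  (forall i, lo <= i < lo + K -> C i) -> (forall i, lo + K <= i -> C (i - K) -> C i) ->
  forall i, lo <= i -> C i.
Proof.
move=> K0 base step i; have [n] : exists n : nat, (i - lo <= n%:Z) by exists `|i - lo|%N; lia.
elim: n i => [|n IH] i hn hi; first by apply: base; lia.
case: (ltP i (lo + K)) => h; first by apply: base; lia.
by apply: step => //; apply: IH; lia.
Qed.

Variables (T K k sg : int).
Hypothesis T0 : 0 < T.
(* For k = 0 the period 8 T exceeds the spread of t^m P - Q for all the shifts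
   that are considered. *)
Hypothesis cases_k : [\/ [/\ 0 < k, k < T, K = k & sg = 1],
  [/\ k < 0, - T < k, K = - k & sg = - 1] | [/\ k = 0, K = 8 * T & sg = 1]].

Definition prefix_of P r : Prop :=
  (forall i, r i = P@_i *~ sg + r (i - K)) /\ (forall i, i < - T -> r i = 0).

Variables (P Q : laurent R) (prefP prefQ : int -> R).
Hypothesis supP : forall i : int, (i <= - T) || (T <= i) -> P@_i = 0.
Hypothesis supQ : forall i : int, (i <= - T) || (T <= i) -> Q@_i = 0.
Hypothesis preP : prefix_of P prefP.
Hypothesis preQ : prefix_of Q prefQ.

Local Notation diff := (shifted_diff prefP prefQ).

Definition shift_matches (m : int) : Prop :=
  forall i, 3 * T <= i < 3 * T + K -> prefQ i = prefP (i - m).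

Let K0 : 0 < K.
Proof. by case: cases_k => -[]; lia. Qed.

Let diff_rec (m i : int) : diff m i = (Q@_i - P@_(i - m)) *~ sg + diff m (i - K).
Proof.
rewrite /shifted_diff preQ.1 preP.1 mulrzBl.
have -> : i - m - K = i - K - m by ring.
by rewrite opprD addrACA.
Qed.

Lemma diff_low (m i : int) : - (2 * T) <= m <= 2 * T -> i < - (3 * T) -> diff m i = 0.
Proof. by move=> hm hi; rewrite /shifted_diff preQ.2 ?preP.2 ?subrr //; lia. Qed.

Lemma diff_step (m i : int) : - (2 * T) <= m <= 2 * T -> 3 * T < i -> diff m i = diff m (i - K).
Proof.
move=> hm hi; rewrite diff_rec supQ ?supP ?subrr ?mul0rz ?add0r //; lia.
Qed.

(** To the right of the supports the quotient has period K, so that it is zero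
    there as soon as it vanishes on one period. *)
Lemma diff_high (m i : int) : - (2 * T) <= m <= 2 * T -> shift_matches m ->
  3 * T <= i -> diff m i = 0.
Proof.
move=> hm sm; apply: (int_above_ind (C := fun i => diff m i = 0) K0) => j hj.
  by rewrite /shifted_diff sm ?subrr.
by rewrite (@diff_step m j hm) //; lia.
Qed.

(** A negative k turns t^k - 1 into - t^k (t^K - 1). This accounts for the sign sg
    and for the translation of F by K. *)
Lemma shift_matches_conj (m : int) F :
  - (2 * T) <= m <= 2 * T -> shift_matches m ->
  (forall i, F@_i = diff m (i - (if k < 0 then K else 0))) ->
  (((F, m) : gamma2 R) * ((P, k) : gamma2 R) = ((Q, k) : gamma2 R) * ((F, m) : gamma2 R))%g.
Proof.
move=> hm sm hF; apply/conj_coefP; split=> // i; rewrite !hF.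
have := diff_rec m i.
case: cases_k => -[h1 h2 h3 h4].
- have -> : (k < 0) = false by lia.
  rewrite !subr0 -h3 h4 mulr1z => ->; rewrite addrAC subrK //.
- rewrite h1 h4 mulrN1z opprB => e.
  have -> : i - k - K = i by lia.
  by rewrite e [RHS]addrCA [RHS]addrA subrK addrC.
- have -> : (k < 0) = false by lia.
  rewrite !subr0 h1 !subr0.
  have z j : - (3 * T) <= j -> j <= 3 * T -> diff m j = 0.
    move=> j1 j2; have := @diff_step m (j + K) hm; rewrite addrK => <-; last by lia.
    by apply: diff_high => //; lia.
  have zz j : diff m j = 0.
    case: (ltP j (- (3 * T))) => j1; first exact: diff_low.
    by case: (leP j (3 * T)) => j2; [exact: z | apply: diff_high => //; lia].
  move: h4; rewrite !zz h3 mulr1z addr0 => /eqP.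
  by rewrite eq_sym subr_eq0 => /eqP ->; rewrite addrC.
Qed.

Lemma malg_support F : exists B : int, forall i : int, (i < - B) || (B < i) -> F@_i = 0.
Proof.
exists (\sum_(j <- msupp F) `|j|) => i hi; apply: mcoeff_outdom; apply/negP => iF.
move: hi; rewrite (big_rem _ iF) /=.
have : 0 <= \sum_(j <- rem i (msupp F)) `|j| by apply: sumr_ge0.
set S := \sum_(_ <- _) _; lia.
Qed.

Lemma prefP_period j (n : nat) : T <= j -> prefP (j + n%:Z * K) = prefP j.
Proof.
move=> hj; elim: n => [|n IH]; first by rewrite mul0r addr0.
rewrite preP.1 supP ?mul0rz ?add0r; last by nia.
by rewrite -IH; congr prefP; rewrite -addn1 PoszD; ring.
Qed.

Lemma prefQ_period j (n : nat) : T <= j -> prefQ (j + n%:Z * K) = prefQ j.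
Proof.
move=> hj; elim: n => [|n IH]; first by rewrite mul0r addr0.
rewrite preQ.1 supQ ?mul0rz ?add0r; last by nia.
by rewrite -IH; congr prefQ; rewrite -addn1 PoszD; ring.
Qed.

(** If k = 0 and the given shift m0 is out of range, the supports of t^m0 P and Q
    are disjoint, so P = Q = 0 and the shift 0 will do. If k <> 0 then the given
    F is, up to a translation, the quotient for m0, which therefore vanishes far
    to the right. There the prefix sums are periodic, so that m0 can be reduced
    modulo K. *)
Lemma conj_shift_matches :
  gamma2_conjugate (P, k) (Q, k) ->
  exists2 m : int, - (2 * T) <= m < 2 * T & shift_matches m.
Proof.
case=> -[F m0] /conj_coefP[_ h].
have [k0|k0] := eqVneq k 0.
  have h1 := k0.
  have e i : P@_(i - m0) = Q@_i by have := h i; rewrite h1 subr0 addrC => /addIr.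
  have [m hm em] : exists2 m : int, - (2 * T) <= m < 2 * T & forall i, P@_(i - m) = Q@_i.
    case: (boolP (- (2 * T) <= m0 < 2 * T)) => hm; first by exists m0.
    have e' i : Q@_(i + m0) = P@_i by rewrite -e addrK.
    have Q0 i : Q@_i = 0.
      have [h4|h4] : (i <= - T) || (T <= i) \/ (i - m0 <= - T) || (T <= i - m0) by lia.
        exact: supQ.
      by rewrite -e supP.
    by exists 0 => [|i]; rewrite ?subr0 -?e' ?Q0 //; lia.
  exists m => // i _; apply/eqP; rewrite -subr_eq0; apply/eqP.
  change (diff m i = 0).
  have hm2 : - (2 * T) <= m <= 2 * T by lia.
  have [low|high] := ltP i (- (3 * T)); first exact: diff_low.
  move: (i) (high : - (3 * T) <= i); apply: (@int_above_ind _ K) => // j hj => [|hd].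
    by rewrite diff_rec em subrr mul0rz add0r diff_low //; lia.
  by rewrite diff_rec em subrr mul0rz add0r.
have Kk : K < T by case: cases_k => -[]; lia.
have [F' [B supF] recF] : exists2 F' : int -> R,
    (exists B : int, forall i : int, (i < - B) || (B < i) -> F' i = 0) &
    forall i : int, F' i = (Q@_i - P@_(i - m0)) *~ sg + F' (i - K).
  have [B supF] := malg_support F.
  exists (fun i => F@_(i + (if k < 0 then K else 0))).
    by exists (B + K) => i hi; apply: supF; case: ifP => _; lia.
  move=> i; have {}h := h i.
  case: cases_k => -[h1 h2 h3]; last by lia.
    have -> : (k < 0) = false by lia.
    move=> ->; rewrite !addr0 mulr1z h3.
    by apply: (addIr P@_(i - m0)); rewrite h addrAC subrK.
  rewrite h1 => ->; rewrite mulrN1z opprB subrK.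
  have -> : i + K = i - k by lia.
  by apply: (addrI Q@_i); rewrite -h [RHS]addrCA [RHS]addrA subrK addrC.
have diffF i : diff m0 i = F' i.
  pose L := `|B| + 3 * T + `|m0|.
  have low j : j < - L -> diff m0 j = F' j.
    by rewrite /L => hj; rewrite /shifted_diff preQ.2 ?preP.2 ?supF ?subrr //; lia.
  have [hi|hi] := ltP i (- L); first exact: low.
  move: (i) hi; apply: (@int_above_ind _ K) => // j hj => [|hd].
    by rewrite diff_rec recF low //; lia.
  by rewrite diff_rec recF hd.
have Kn0 : K != 0 by lia.
pose m := (m0 %% K)%Z; pose q := (m0 %/ K)%Z.
have m0E : m0 = q * K + m by exact: divz_eq.
have m_ge0 : 0 <= m by exact: modz_ge0.
have m_lt : m < K by have := ltz_mod m0 Kn0; rewrite -/m; lia.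
exists m; first by lia.
move=> i hi; apply/eqP; rewrite -subr_eq0; apply/eqP.
pose n := (`|q| + `|B|)%N; pose n' := `|n%:Z - q|%N.
rewrite -(@prefQ_period i n) -?(@prefP_period (i - m) n'); try by lia.
have -> : i - m + n'%:Z * K = i + n%:Z * K - m0.
  have -> : n'%:Z = n%:Z - q by lia.
  by rewrite m0E; ring.
change (diff m0 (i + n%:Z * K) = 0); rewrite diffF supF //.
have : n%:Z <= n%:Z * K by nia.
lia.
Qed.

End Conjugacy.

(** * The program *)

Section Program.
Local Open Scope ring_scope.
Local Open Scope cmd_scope.

Variables (N : nat) (d : nat -> nat) (b : nat -> nat -> int) (G : nat).

(** The heap holds the input tape and then, around the address in [rO], one row
    of cells for each exponent: N cells for the coordinates of the coefficient
    of the first polynomial, and N for those of the second. *)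
Definition width : nat := N.*2.

Definition read_word : cmd :=
  Const rCur 0;;
  Repeat id rCnt
    (Const rCnt 0;; Read rX;; Put rPtr rX;; Incr rPtr;;
     IfPos rX (Incr rCur;; Const rCnt 1);;
     IfNeg rX (Decr rCur;; Const rCnt 1)).

Definition read_input : cmd :=
  Const rOne 1;; Const rPtr nregs;;
  read_word;; Move rKu rCur;; read_word;; Move rKv rCur.

Definition compare_exponents : cmd :=
  Const rNeq 0;; Minus rX rKu rKv;;
  IfPos rX (Const rNeq 1);; IfNeg rX (Const rNeq 1).

(** Exponent 0 is put 16 T rows above the end of the tape, which leaves room for
    all the negative exponents that occur. *)
Definition layout : cmd :=
  Const rTmp nregs;; Minus rT rPtr rTmp;;
  Plus rI rT rT;; Plus rI rI rI;; Plus rJ rI rI;; Plus rI rJ rJ;;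
  address width rO rPtr rI.

Definition set_period : cmd :=
  Const rSg 1;; Const rK 0;;
  IfPos rKu (Move rK rKu);;
  IfNeg rKu (Const rSg (- 1);; Minus rK rZero rKu);;
  Unless rK (Move rK rJ).

Definition setup : cmd := layout;; set_period;; compare_exponents.

Definition plot_word : cmd :=
  Const rCur 0;;
  Repeat id rCnt
    (Const rCnt 0;; Get rX rPtr;; Incr rPtr;;
     IfPos rX
       (address width rP rBase rCur;; Plus rP rP rX;;
        Get rA rP;; Plus rA rA rSg;; Put rP rA;;
        Incr rCur;; Const rCnt 1);;
     IfNeg rX
       (Decr rCur;; address width rP rBase rCur;; Minus rP rP rX;;
        Get rA rP;; Minus rA rA rSg;; Put rP rA;;
        Const rCnt 1)).

Definition plot_input : cmd :=
  Const rPtr nregs;; Minus rBase rO rOne;; plot_word;;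
  Const rTmp N;; Plus rBase rBase rTmp;; plot_word.

(** The exponents from -T to 15 T - 1 are enough: the rows that are compared or
    printed lie below 3 T + K <= 11 T, and the shifts are less than 2 T. *)
Definition rows (body : cmd) : cmd :=
  Minus rI rZero rT;;
  Plus rCnt rT rT;; Plus rCnt rCnt rCnt;; Plus rCnt rCnt rCnt;; Plus rCnt rCnt rCnt;;
  Repeat (fun T => 16 * T)%N rCnt (body;; Incr rI;; Decr rCnt).

(** When row i is treated, row i - K already contains its prefix sum. *)
Definition prefix_row : cmd :=
  address width rP rO rI;; Minus rJ rI rK;; address width rQ rO rJ;;
  For width (fun=> Get rA rP;; Get rB rQ;; Plus rA rA rB;; Put rP rA;;
                 Incr rP;; Incr rQ).

Definition add_multiple (z : int) (i : nat) : cmd :=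
  For N (fun j => Const rTmp j;; Plus rQ rP rTmp;; Get rA rQ;;
                  Const rB (z * b i j);; Plus rA rA rB;; Put rQ rA).

Definition get_entry (i : nat) : cmd :=
  Const rTmp i;; Plus rQ rP rTmp;; Get rA rQ.

(** The first loop goes on until the entry is at least d i. Therefore the second
    one has to subtract at least once, and neither needs a preliminary test. *)
Definition reduce (i : nat) : cmd :=
  if d i is 0 then Skip else
  Repeat (fun T => G * T)%N rX
    (add_multiple 1 i;; get_entry i;; Const rTmp (d i);; Minus rX rTmp rA);;
  Repeat (fun T => G * T)%N rX
    (add_multiple (- 1) i;; get_entry i;; Const rTmp (d i)%:Z;; Minus rX rA rTmp;;
     Incr rX).

Definition normalize_row : cmd :=
  address width rP rO rI;; For N reduce;;
  Const rTmp N;; Plus rP rP rTmp;; For N reduce.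

Definition locate : cmd :=
  address width rP rO rI;; Const rTmp N;; Plus rP rP rTmp;;
  Minus rJ rI rM;; address width rQ rO rJ.

(** [rX] becomes positive at the first mismatch. Its initial value [rNeq] makes
    every shift fail when the exponents of t differ. *)
Definition try_shift : cmd :=
  Move rX rNeq;; Plus rI rT rT;; Plus rI rI rT;; Move rInner rK;;
  Repeat (fun T => 8 * T)%N rInner
    (locate;;
     For N (fun=> Get rB rP;; Get rA rQ;; Minus rA rB rA;;
                  IfPos rA (Const rX 1);; IfNeg rA (Const rX 1);;
                  Incr rP;; Incr rQ);;
     Incr rI;; Decr rInner);;
  Unless rX (Const rFound 1;; Move rRes rM).

Definition search : cmd :=
  Const rFound 0;;
  Plus rCnt rT rT;; Minus rM rZero rCnt;; Plus rCnt rCnt rCnt;;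
  Repeat (fun T => 4 * T)%N rCnt (try_shift;; Incr rM;; Decr rCnt).

Definition print_conjugator : cmd :=
  Emit rOne;; Emit rRes;;
  Plus rInner rT rT;; Plus rInner rInner rT;; Minus rI rZero rInner;;
  Plus rInner rInner rInner;; Plus rInner rInner rK;;
  Move rA rI;; IfNeg rKu (Plus rA rA rK);; Emit rA;;
  Move rM rRes;;
  Repeat (fun T => 14 * T)%N rInner
    (locate;;
     For N (fun=> Get rB rP;; Get rA rQ;; Minus rA rB rA;; Emit rA;;
                  Incr rP;; Incr rQ);;
     Incr rI;; Decr rInner).

Definition output : cmd :=
  Unless rFound (Emit rZero);; Minus rX rOne rFound;; Unless rX print_conjugator.

Definition main : cmd :=
  read_input;; setup;; plot_input;; rows prefix_row;; rows normalize_row;;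
  search;; output.

End Program.

Arguments width : simpl never.

(** * Symbolic execution of the phases *)

Section Phases.
Local Open Scope ring_scope.
Variables (R : comPzRingType) (X : {fset R}) (T W : nat).
Notation N := #|{: X}|.
Notation lin := (@lin R X).
Notation wp := (wp T W).
Notation bnd := (fits W).

Definition tape_at (s : state) (tp : seq int) : Prop :=
  forall j, hp s (nregs + j) = nth 0 tp j.

Lemma tape_at_rcons s tp z :
  tape_at s tp -> tape_at (seth s (nregs + size tp) z) (rcons tp z).
Proof.
move=> h j; rewrite /= /upd eqn_add2l nth_rcons h.
case: ltngtP => // hj; first by rewrite nth_default // ltnW.
Qed.

Lemma wp_read_word (w : word X) rest tp (Q : state -> Prop) s :
  si s = word_code w ++ 0 :: rest -> tape_at s tp ->
  rg s rPtr = (nregs + size tp)%:Z -> rg s rOne = 1 -> (size w < T)%N ->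
  (nregs + size tp + N + T < W)%N ->
  (forall s', changes_only [:: rCur; rCnt; rX; rPtr; rTmp] s s' -> si s' = rest ->
     so s' = so s -> tape_at s' (tp ++ rcons (word_code w) 0) ->
     rg s' rPtr = (nregs + size tp + (size w).+1)%:Z -> rg s' rCur = expo w ->
     Q s') ->
  wp read_word Q s.
Proof.
move=> hsi htp hptr h1 hT hW HQ; split; first by rewrite /fits.
pose I n s' := exists w1 w2, w = w1 ++ w2 /\ [/\ (size w2 < n)%N,
  changes_only [:: rCur; rCnt; rX; rPtr; rTmp] s s', si s' = word_code w2 ++ 0 :: rest,
  so s' = so s & [/\ tape_at s' (tp ++ word_code w1),
  rg s' rPtr = (nregs + size tp + size w1)%:Z & rg s' rCur = expo w1]].
apply: (wp_repeat (I := I)); last first.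
- exists [::], w; split=> //; split=> //.
    by apply: changes_only_setr.
  by rewrite cats0 addn0; split=> //; rewrite /expo big_nil.
- by move=> s' [w1 [w2 [_ []]]].
move=> n s' [w1 [w2 [ew [hn cl hsi' hso [htp' hptr' hcur]]]]].
have ex := expo_bound w1.
have sw : (size w1 + size w2 = size w)%N by rewrite ew size_cat.
have tsz : size (tp ++ word_code w1) = (size tp + size w1)%N.
  by rewrite size_cat size_map.
have one : rg s' rOne = 1 by rewrite cl.
case: w2 => [|[x b] w2] in ew hn hsi' sw *; rewrite /= hsi' /= one hptr'.
  rewrite /= in sw; do 4 (split; first by bounds).
  apply: wp_ifpos => //=; first by bounds.
  move=> _; apply: wp_ifneg => //=; first by bounds.
  move=> _; apply: HQ => //=; try solve [track_changes].
  - by rewrite hsi'.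
  - by move: (tape_at_rcons 0 htp'); rewrite rcons_cat tsz addnA ew cats0.
  - lia.
  - by rewrite hcur ew cats0.
have lc : letter_code (x, b) = if b then (enum_rank x).+1%:Z else - (enum_rank x).+1%:Z.
  by [].
have xN : (enum_rank x < N)%N by [].
set rk : nat := enum_rank x in lc xN.
rewrite /= in sw hn.
have exS : expo (rcons w1 (x, b)) = expo w1 + if b then 1 else - 1.
  by rewrite /expo -cats1 big_cat big_seq1.
have htpS : tape_at (seth s' (nregs + size tp + size w1) (letter_code (x, b)))
    (tp ++ word_code (rcons w1 (x, b))).
  move: (tape_at_rcons (letter_code (x, b)) htp').
  by rewrite rcons_cat tsz addnA /word_code map_rcons.
have ewS : w = rcons w1 (x, b) ++ w2 by rewrite cat_rcons.
have fin s'' : changes_only [:: rCur; rCnt; rX; rPtr; rTmp] s s'' ->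
    si s'' = behead (si s') -> so s'' = so s' ->
    hp s'' = hp (seth s' (nregs + size tp + size w1) (letter_code (x, b))) ->
    rg s'' rPtr = (nregs + size tp + size w1)%:Z + 1 ->
    rg s'' rCur = expo w1 + (if b then 1 else - 1) -> I n s''.
  move=> clS siS soS hpS ptrS curS; exists (rcons w1 (x, b)), w2.
  split=> //; split=> //; rewrite ?siS ?hsi' ?soS //.
  split; first by rewrite /tape_at hpS.
    by rewrite ptrS size_rcons; lia.
  by rewrite curS exS.
rewrite lc in fin *.
do 4 (split; first by case: (b) lc; bounds).
apply: wp_ifpos => //=; first by case: (b) lc; bounds.
  case: b lc fin {ew exS htpS ewS hsi'} => lc fin; last by bounds.
  move=> _; rewrite one hcur; do 2 (split; first by bounds).
  apply: wp_ifneg => //=; try (by bounds).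
  by move=> _; apply: fin => //=; track_changes.
case: b lc fin {ew exS htpS ewS hsi'} => lc fin; first by bounds.
move=> _; apply: wp_ifneg => //=; try (by bounds).
move=> _; rewrite one hcur; do 2 (split; first by bounds).
by rewrite /=; apply: fin => //=; track_changes.
Qed.
Opaque read_word.

Hypothesis T0 : (0 < T)%N.
Hypothesis HW : (nregs + 2 * N + 64 * T + 64 * (width N * T) < W)%N.

Lemma wp_read_input (u v : word X) (Q : state -> Prop) :
  T = (size u + size v + 2)%N ->
  (forall s, so s = [::] -> tape_at s (rcons (word_code u) 0 ++ rcons (word_code v) 0) ->
     rg s rZero = 0 -> rg s rOne = 1 -> rg s rPtr = (nregs + T)%:Z ->
     rg s rKu = expo u -> rg s rKv = expo v -> Q s) ->
  wp read_input Q (blank (input_code u v)).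
Proof.
move=> hT HQ; have eu := expo_bound u; have ev := expo_bound v.
do 2 (split; first by rewrite /fits /nregs; lia).
rewrite /=; apply: (wp_read_word (w := u) (rest := word_code v ++ [:: 0]) (tp := [::])) => //=.
- by move=> j; rewrite nth_nil.
- by lia.
- by lia.
move=> s cl hsi hso htp hptr hcur.
have z0 : rg s rZero = 0 by rewrite cl.
have o1 : rg s rOne = 1 by rewrite cl.
rewrite z0 addr0; split; first by rewrite hcur; bounds.
apply: (wp_read_word (w := v) (rest := [::]) (tp := rcons (word_code u) 0)) => //=.
- by rewrite hptr size_rcons size_map.
- by lia.
- by rewrite size_rcons size_map; lia.
move=> s' cl' hsi' hso' htp' hptr' hcur'.
have z0' : rg s' rZero = 0 by rewrite cl'.
rewrite z0' addr0; split; first by rewrite hcur'; bounds.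
apply: HQ => //=.
- by rewrite hso' /= hso.
- by rewrite cl'.
- by rewrite hptr' size_rcons size_map; lia.
- by rewrite cl'.
Qed.

Variables (O K ku sg nq : int).
Hypothesis HO : O = nregs%:Z + T%:Z + 16 * (width N)%:Z * T%:Z.
Hypothesis HK : 0 < K <= 8 * T%:Z.

Definition consts (s : state) : Prop :=
  [/\ rg s rZero = 0, rg s rOne = 1, rg s rT = T%:Z, rg s rO = O &
   [/\ rg s rK = K, rg s rKu = ku, rg s rSg = sg & rg s rNeq = nq]].

Section Setup.
Variable kv : int.
Hypothesis hK : K = (if ku == 0 then 8 * T%:Z else `|ku|).
Hypothesis hsg : sg = (if ku < 0 then - 1 else 1).
Hypothesis hnq : nq = (ku != kv)%:R.
Hypothesis bku : - T%:Z < ku < T%:Z.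
Hypothesis bkv : - T%:Z < kv < T%:Z.

Lemma wp_compare_exponents (Q : state -> Prop) s :
  [/\ rg s rZero = 0, rg s rOne = 1, rg s rT = T%:Z, rg s rO = O &
   [/\ rg s rK = K, rg s rKu = ku, rg s rSg = sg & rg s rKv = kv]] ->
  (forall s', consts s' -> hp s' = hp s -> so s' = so s -> Q s') ->
  wp compare_exponents Q s.
Proof.
move=> [z0 one hT hO [hK' hku hsg' hkv]] HQ.
rewrite /= hku hkv; do 2 (split; first by bounds).
apply: wp_ifpos => //=; first by bounds.
  move=> h; have ne : ku != kv by lia.
  split; first by bounds.
  apply: wp_ifneg => //=; first by bounds.
    by lia.
  by move=> _; apply: HQ => //; split=> //; split=> //=; rewrite hnq ne.
move=> h; apply: wp_ifneg => //=; first by bounds.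
  move=> h'; have ne : ku != kv by lia.
  split; first by bounds.
  by apply: HQ => //; split=> //; split=> //=; rewrite hnq ne.
move=> h'; have e : ku = kv by lia.
by apply: HQ => //; split=> //; split=> //=; rewrite hnq e eqxx.
Qed.

Lemma wp_layout (Q : state -> Prop) s :
  rg s rZero = 0 -> rg s rPtr = (nregs + T)%:Z ->
  (forall s', changes_only [:: rT; rI; rJ; rO; rTmp] s s' -> hp s' = hp s -> so s' = so s ->
     rg s' rT = T%:Z -> rg s' rO = O -> rg s' rJ = 8 * T%:Z -> Q s') ->
  wp (layout N) Q s.
Proof.
move=> z0 hptr HQ; rewrite /= hptr.
have -> : (nregs + T)%:Z - nregs%:Z = T by lia.
do 6 (split; first by rewrite /fits /nregs; lia).
have T8 : T%:Z + T + (T%:Z + T) + (T%:Z + T + (T%:Z + T)) = 8 * T%:Z by ring.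
rewrite T8; apply: wp_address => //=.
  rewrite hptr ger0_norm ?ger0_norm; lia.
have -> : rg s rPtr + (width N)%:Z * (8 * T%:Z + 8 * T%:Z) = O.
  by rewrite hptr HO PoszD; ring.
by apply: HQ => //=; track_changes.
Qed.

Lemma wp_set_period (Q : state -> Prop) s :
  rg s rZero = 0 -> rg s rOne = 1 -> rg s rKu = ku -> rg s rJ = 8 * T%:Z ->
  (forall s', changes_only [:: rSg; rK; rTmp] s s' -> hp s' = hp s -> so s' = so s ->
     rg s' rSg = sg -> rg s' rK = K -> Q s') ->
  wp set_period Q s.
Proof.
move=> z0 one hku hJ HQ.
have period s0 : changes_only [:: rSg; rK; rTmp] s s0 -> hp s0 = hp s -> so s0 = so s ->
    rg s0 rSg = sg -> rg s0 rK = `|ku| -> wp (Unless rK (Move rK rJ)) Q s0.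
  move=> cl hhp hso hs hk; have z1 : rg s0 rZero = 0 by rewrite cl.
  have hJ1 : rg s0 rJ = 8 * T%:Z by rewrite cl.
  rewrite /= hk hJ1 z1 addr0; case: ifP => h.
    by apply: HQ => //; rewrite hk hK; case: eqP h => // ->.
  split; first by bounds.
  apply: HQ => //=; first by track_changes.
  by rewrite hK; case: eqP => //; lia.
rewrite /set_period; move: (Unless rK _) period => last period /=.
do 2 (split; first by bounds).
apply: wp_ifpos => //=; rewrite ?hku; first by bounds.
  move=> h; have sg1 : 1 = sg by rewrite hsg; case: ifP => //; lia.
  split; first by rewrite /= z0; bounds.
  apply: wp_ifneg => //=; rewrite ?hku; [by bounds | by lia |] => h'.
  by apply: period => //=; [track_changes | rewrite z0 addr0 gtr0_norm].
move=> h; apply: wp_ifneg => //=; rewrite ?hku; first by bounds.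
  move=> h'; have sg1 : - 1 = sg by rewrite hsg h'.
  rewrite z0; do 2 (split; first by bounds).
  by apply: period => //=; [track_changes | rewrite sub0r ltr0_norm].
move=> h'; have k0 : ku = 0 by lia.
have sg1 : 1 = sg by rewrite hsg k0.
by apply: period => //=; [track_changes | rewrite k0].
Qed.

Lemma wp_setup (Q : state -> Prop) s :
  rg s rZero = 0 -> rg s rOne = 1 -> rg s rPtr = (nregs + T)%:Z ->
  rg s rKu = ku -> rg s rKv = kv ->
  (forall s', consts s' -> hp s' = hp s -> so s' = so s -> Q s') ->
  wp (setup N) Q s.
Proof.
move=> z0 one hptr hku hkv HQ.
rewrite /setup wp_seq; apply: wp_layout => // s1 cl1 hp1 so1 hT1 hO1 hJ1.
rewrite wp_seq; apply: wp_set_period => //; try by rewrite cl1.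
move=> s2 cl2 hp2 so2 hsg2 hK2.
apply: wp_compare_exponents => [|s3 cs3 hp3 so3].
  split; [by rewrite cl2 // cl1 | by rewrite cl2 // cl1 | by rewrite cl2 | by rewrite cl2 |].
  by split; [| rewrite cl2 // cl1 | | rewrite cl2 // cl1].
by apply: HQ => //; rewrite ?hp3 ?so3 ?hp2 ?so2.
Qed.
End Setup.

Definition addr (i : int) (y : nat) : int := O + (width N)%:Z * i + y%:Z.

Lemma addrS i y : addr i y + 1 = addr i y.+1.
Proof. by rewrite /addr; lia. Qed.

Lemma addr_ge i y : - (16 * T%:Z) <= i -> nregs%:Z + T%:Z <= addr i y.
Proof.
move=> hi; rewrite /addr HO.
have : (width N)%:Z * (- (16 * T%:Z)) <= (width N)%:Z * i by apply: ler_wpM2l.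
lia.
Qed.

Lemma addr_le i y : i <= 16 * T%:Z -> (y <= width N)%N -> addr i y < W%:Z.
Proof.
move=> hi hy; have hy2 : (y <= 2 * N)%N by rewrite /width in hy; lia.
rewrite /addr HO; have : (width N)%:Z * i <= (width N)%:Z * (16 * T%:Z) by apply: ler_wpM2l.
lia.
Qed.

Lemma address_bound i : - (16 * T%:Z) <= i <= 16 * T%:Z ->
  `|O| + (width N)%:Z * `|i| <= W%:Z.
Proof.
move=> hi; have : (width N)%:Z * `|i| <= (width N)%:Z * (16 * T%:Z).
  by apply: ler_wpM2l => //; lia.
rewrite HO; lia.
Qed.

Lemma addr_inj i y i' y' : - (16 * T%:Z) <= i -> - (16 * T%:Z) <= i' ->
  (y < width N)%N -> (y' < width N)%N ->
  (`|addr i y| == `|addr i' y'|)%N = (i == i') && (y == y').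
Proof.
move=> hi hi' hy hy'; have := addr_ge y hi; have := addr_ge y' hi'.
move=> h h'; apply/eqP/andP => [e|[/eqP -> /eqP ->] //].
have {h h'}e : (width N)%:Z * (i - i') = y'%:Z - y%:Z.
  by rewrite mulrBr; move: h h' e; rewrite /addr; lia.
have ii : i = i'.
  case: (ltgtP i i') => // ii.
    have : (width N)%:Z * (i - i') <= (width N)%:Z * (- 1) by apply: ler_wpM2l; lia.
    lia.
  have : (width N)%:Z * 1 <= (width N)%:Z * (i - i') by apply: ler_wpM2l; lia.
  lia.
by move: e; rewrite ii subrr mulr0 => e; split; lia.
Qed.

Definition holds_array (h : nat -> int) (f : int -> nat -> int) : Prop :=
  forall i y, - (16 * T%:Z) <= i -> (y < width N)%N -> h `|addr i y|%N = f i y.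

Lemma holds_array_upd h f f' i y z : holds_array h f -> - (16 * T%:Z) <= i -> (y < width N)%N ->
  (forall i' y', (y' < width N)%N ->
     f' i' y' = if (i' == i) && (y' == y) then z else f i' y') ->
  holds_array (upd h `|addr i y|%N z) f'.
Proof.
move=> hh hi hy hf i' y' hi' hy'.
by rewrite /upd addr_inj // hf // hh.
Qed.

Definition tape_low (s : state) (tp : seq int) : Prop :=
  forall j, (j < T)%N -> hp s (nregs + j) = nth 0 tp j.

Lemma tape_low_seth s tp i y z : tape_low s tp -> - (16 * T%:Z) <= i ->
  tape_low (seth s `|addr i y|%N z) tp.
Proof.
move=> h hi j jT; rewrite /= /upd ifF ?h //.
by have := addr_ge y hi; lia.
Qed.

Lemma consts_changes_only l s s' : changes_only l s s' ->
  all (fun r => r \notin l) [:: rZero; rOne; rT; rO; rK; rKu; rSg; rNeq] ->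
  consts s -> consts s'.
Proof.
move=> cl /= /and5P[l0 l1 l2 l3 /and5P[l4 l5 l6 l7 _]] [? ? ? ? [? ? ? ?]].
by split; rewrite ?cl //; split; rewrite cl.
Qed.

Lemma consts_setr s r z : r \notin [:: rZero; rOne; rT; rO; rK; rKu; rSg; rNeq] ->
  consts s -> consts (setr s r z).
Proof.
move=> hr; apply: (@consts_changes_only [:: r]); first by apply: changes_only_setr; rewrite ?inE.
by case: r hr.
Qed.

Ltac track_consts := repeat lazymatch goal with
  | |- consts (setr _ _ _) => apply: consts_setr; [by [] |]
  end; try assumption.

(** The offset off, 0 or N, selects the half of each row that belongs to the
    word. *)
Lemma wp_plot_word (w : word X) tp l off f (v : nat) (Q : state -> Prop) s :
  (off + N <= N.*2)%N -> (l + size w < T)%N ->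
  (forall j, (j <= size w)%N -> nth 0 tp (l + j) = nth 0 (word_code w) j) ->
  `|sg| <= 1 -> consts s -> tape_low s tp -> holds_array (hp s) f ->
  rg s rPtr = (nregs + l)%:Z -> rg s rBase = O - 1 + off%:Z ->
  (forall i y, `|f i y| <= v%:Z) -> (v + size w <= T)%N ->
  (forall s', changes_only [:: rCur; rCnt; rX; rPtr; rTmp; rP; rA] s s' -> so s' = so s ->
     tape_low s' tp -> rg s' rPtr = (nregs + l + (size w).+1)%:Z ->
     holds_array (hp s') (fun i y => f i y +
       if (off <= y)%N then coef (marks sg 0 w) i (y - off)%N else 0) -> Q s') ->
  wp (plot_word N) Q s.
Proof.
move=> hoff hl hnth hsg cs tl af hptr hbase bf hv HQ; split; first by bounds.
pose F (w1 : word X) := fun i y => f i y +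
  if (off <= y)%N then coef (marks sg 0 w1) i (y - off)%N else 0.
pose I n s' := exists w1 w2, w = w1 ++ w2 /\ [/\ (size w2 < n)%N,
  changes_only [:: rCur; rCnt; rX; rPtr; rTmp; rP; rA] s s', so s' = so s,
  tape_low s' tp & [/\ holds_array (hp s') (F w1), (forall i y, `|F w1 i y| <= (v + size w1)%:Z),
    rg s' rPtr = (nregs + l + size w1)%:Z & rg s' rCur = expo w1]].
apply: (wp_repeat (I := I)); last first.
- exists [::], w; split=> //; split=> //; [by rewrite /=; lia | by track_changes |].
  have F0 i y : F [::] i y = f i y by rewrite /F /coef big_nil if_same addr0.
  split=> //=; last by rewrite /expo big_nil.
  - by move=> i y hi hy; rewrite F0; apply: af.
  - by move=> i y; rewrite F0 addn0.
  - by rewrite addn0.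
- by move=> s' [w1 [w2 [_ []]]].
move=> n s' [w1 [w2 [ew [hn cl hso tl' [af' bF hptr' hcur]]]]].
have ex := expo_bound w1.
have sw : (size w1 + size w2 = size w)%N by rewrite ew size_cat.
have cs' : consts s' by apply: consts_changes_only cl _ cs.
have [z0 one hT hO [hK hku hsg' hnq]] := cs'.
have hbase' : rg s' rBase = O - 1 + off%:Z by rewrite cl.
have hc : hp s' (nregs + l + size w1)%N = nth 0 (word_code w) (size w1).
  by rewrite -addnA tl' ?hnth //; lia.
have sc : size (word_code w1) = size w1 by rewrite size_map.
rewrite /= hptr' absz_nat hc one.
case: w2 => [|[x b] w2] in ew hn hc sw *.
  have -> : nth 0 (word_code w) (size w1) = 0.
    by rewrite nth_default // ew size_map cats0.
  rewrite /= in sw; do 3 (split; first by bounds).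
  apply: wp_ifpos => //=; first by bounds.
  move=> _; apply: wp_ifneg => //=; first by bounds.
  move=> _; apply: HQ => //=; try solve [track_changes].
    by lia.
  by rewrite ew cats0.
have -> : nth 0 (word_code w) (size w1) = letter_code (x, b).
  by rewrite ew /word_code map_cat nth_cat size_map ltnn subnn.
have xN : (enum_rank x < N)%N by [].
pose rk : nat := enum_rank x; rewrite -/rk in xN.
have -> : letter_code (x, b) = if b then rk.+1%:Z else - rk.+1%:Z by [].
rewrite /= in sw hn.
pose c := if b then expo w1 else expo w1 - 1.
have hcT : - (T%:Z) <= c <= T%:Z by rewrite /c; case: (b); lia.
have hyS : (off + rk < width N)%N by rewrite /width; lia.
pose z := F w1 c (off + rk)%N + (if b then sg else - sg).
have fin s'' : changes_only [:: rCur; rCnt; rX; rPtr; rTmp; rP; rA] s s'' -> so s'' = so s' ->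
    hp s'' = hp (seth s' `|addr c (off + rk)%N|%N z) ->
    rg s'' rPtr = (nregs + l + size w1)%:Z + 1 ->
    rg s'' rCur = expo w1 + (if b then 1 else - 1) -> I n s''.
  move=> clS soS hpS ptrS curS; exists (rcons w1 (x, b)), w2.
  have FS i y : F (rcons w1 (x, b)) i y =
      if (i == c) && (y == off + rk)%N then z else F w1 i y.
    rewrite /F marks_rcons !add0r; set m := if b then _ else _.
    have [m1 m2 m3] : [/\ m.1.1 = c, m.1.2 = rk & m.2 = if b then sg else - sg].
      by rewrite /m /c; case: (b).
    case: (leqP off y) => hy; last first.
      by rewrite ifF // [(y == _)]ltn_eqF ?andbF // ltn_addr.
    rewrite coef_rcons m1 m2 m3 [c == i]eq_sym.
    have -> : (y == off + rk)%N = (rk == y - off)%N by lia.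
    case: eqP => [->|_] /=; last by rewrite addr0.
    case: eqP => [e|_]; last by rewrite addr0.
    have ey : y = (off + rk)%N by lia.
    by rewrite ey /z /F leq_addr addKn addrA.
  have cS : - (16 * T%:Z) <= c by lia.
  split; first by rewrite cat_rcons.
  split=> //; rewrite ?soS //.
    by move=> j jT; rewrite hpS; apply: tape_low_seth tl' cS _ jT.
  split.
  - move=> i y hi hy; rewrite hpS; apply: (holds_array_upd af') => // i' y' hy'.
  - move=> i y; rewrite FS size_rcons addnS; case: ifP => _; last by have := bF i y; lia.
    by rewrite /z; have := bF c (off + rk)%N; case: (b); lia.
  - by rewrite ptrS size_rcons; lia.
  - by rewrite curS expo_rcons.
do 3 (split; first by case: (b); bounds).
have hcb : (width N)%:Z * `|c| <= (width N)%:Z * T%:Z by apply: ler_wpM2l; lia.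
have af_c : hp s' `|addr c (off + rk)%N|%N = F w1 c (off + rk)%N by apply: af' => //; lia.
have bz := bF c (off + rk)%N.
have ge_c : nregs%:Z <= addr c (off + rk)%N by apply: le_trans (addr_ge _ _); lia.
have le_c : addr c (off + rk)%N < W%:Z by apply: addr_le => //; lia.
apply: wp_ifpos => //=; first by case: (b); bounds.
  case eb: (b); last by lia.
  have cE : c = expo w1 by rewrite /c eb.
  have zE : z = F w1 c (off + rk)%N + sg by rewrite /z eb.
  rewrite eb in fin.
  move=> _; apply: wp_address => //=; rewrite ?hbase' ?hcur //.
    rewrite -cE; lia.
  have -> : O - 1 + off%:Z + (width N)%:Z * expo w1 + rk.+1%:Z = addr c (off + rk)%N.
    by rewrite /addr cE -addn1 !PoszD; ring.
  split; first by rewrite /fits; lia.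
  split; first by [].
  rewrite hsg' af_c -zE.
  split; first by rewrite /fits zE; lia.
  split; first by [].
  do 2 (split; first by bounds).
  apply: wp_ifneg => //=; try (by bounds).
  by move=> _; apply: fin => //=; [track_changes | rewrite one].
case eb: (b); first by lia.
have cE : c = expo w1 - 1 by rewrite /c eb.
have zE : z = F w1 c (off + rk)%N - sg by rewrite /z eb.
rewrite eb in fin.
move=> _; apply: wp_ifneg => //=; try (by bounds).
move=> _; rewrite hcur one; split; first by bounds.
apply: wp_address => //=; rewrite ?hbase' //.
  rewrite -cE; lia.
have -> : O - 1 + off%:Z + (width N)%:Z * (expo w1 - 1) - - rk.+1%:Z = addr c (off + rk)%N.
  by rewrite /addr cE -addn1 !PoszD; ring.
split; first by rewrite /fits; lia.
split; first by [].
rewrite hsg' af_c -zE.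
split; first by rewrite /fits zE; lia.
split; first by [].
split; first by bounds.
by apply: fin => //=; track_changes.
Qed.

Opaque plot_word.

Definition side_by_side (f g : int -> nat -> int) (i : int) (y : nat) : int :=
  if (y < N)%N then f i y else g i (y - N)%N.

Lemma wp_plot_input (u v : word X) (Q : state -> Prop) s :
  T = (size u + size v + 2)%N -> `|sg| <= 1 -> consts s ->
  tape_at s (rcons (word_code u) 0 ++ rcons (word_code v) 0) ->
  (forall s', consts s' -> so s' = so s ->
     holds_array (hp s') (side_by_side (coef (marks sg 0 u)) (coef (marks sg 0 v))) -> Q s') ->
  wp (plot_input N) Q s.
Proof.
move=> hT hsg cs htp HQ; set tp := _ ++ _ in htp.
have tl : tape_low s tp by move=> j _; apply: htp.
have a0 : holds_array (hp s) (fun _ _ => 0).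
  move=> i y hi hy; have := addr_ge y hi.
  move=> h; have -> : `|addr i y|%N = (nregs + (`|addr i y| - nregs))%N by lia.
  by rewrite htp nth_default // /tp size_cat !size_rcons !size_map; lia.
have [z0 one hT' hO [hK hku hsg' hnq]] := cs.
split; first by rewrite /fits /nregs; lia.
rewrite /= hO one; split; first by rewrite /fits HO; lia.
apply: (wp_plot_word (w := u) (tp := tp) (l := 0) (off := 0)
  (v := 0) (f := fun _ _ => 0)) => //=.
- by lia.
- by lia.
- by move=> j hj; rewrite /tp cat_rcons add0n nth_cat size_map;
    case: (ltngtP j (size u)) hj => // -> _;
    rewrite subnn /= nth_default ?size_map.
- by rewrite addr0.
- by lia.
move=> s' cl hso tl' hptr af.
have cs' : consts s' by apply: consts_changes_only cl _ _.
have [z0' one' _ _ _] := cs'.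
split; first by rewrite /fits; lia.
split; first by rewrite cl //= HO; bounds.
apply: (wp_plot_word (w := v) (tp := tp) (l := (size u).+1) (off := N)
  (v := size u) (f := fun i y => 0 + coef (marks sg 0 u) i (y - 0))) => //=.
- by rewrite addnn.
- by lia.
- move=> j hj; rewrite /tp nth_cat size_rcons size_map ltnNge leq_addr /= addKn.
  rewrite nth_rcons size_map; case: (ltngtP j (size v)) hj => // -> _.
  by rewrite nth_default ?size_map.
- by rewrite cl.
- move=> i y; rewrite add0r subn0 /=.
  have := coef_bound (sg := sg) 0 u i y hsg; lia.
- by lia.
move=> s'' cl2 hso2 tl2 hptr2 af2; apply: HQ.
- by apply: consts_changes_only cl2 _ _.
- by rewrite hso2 /= hso.
- move=> i y hi hy; rewrite af2 // add0r subn0 /= /side_by_side ltnNge.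
  by case: leqP => hyN; rewrite ?addr0 //= coef_large ?add0r.
Qed.

(** J i describes the heap when the rows before i have been treated. *)
Lemma wp_rows (J : int -> (nat -> int) -> Prop) body (Q : state -> Prop) s :
  consts s -> J (- T%:Z) (hp s) ->
  (forall i s1 (Q1 : state -> Prop), - T%:Z <= i < 15 * T%:Z -> consts s1 ->
     rg s1 rI = i -> J i (hp s1) ->
     (forall s2, consts s2 -> rg s2 rI = i -> rg s2 rCnt = rg s1 rCnt ->
        so s2 = so s1 -> J (i + 1) (hp s2) -> Q1 s2) -> wp body Q1 s1) ->
  (forall s', consts s' -> so s' = so s -> J (15 * T%:Z) (hp s') -> Q s') ->
  wp (rows body) Q s.
Proof.
move=> cs J0 step fin; have [z0 one hT hO _] := cs.
rewrite /rows; move EL: (Repeat _ _ _) => L; rewrite /= z0 hT.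
do 5 (split; first by bounds).
rewrite -EL.
pose I n s' := [/\ consts s', so s' = so s, rg s' rCnt = 15 * T%:Z - rg s' rI &
  [/\ - T%:Z <= rg s' rI < 15 * T%:Z, rg s' rCnt <= n%:Z & J (rg s' rI) (hp s')]].
apply: (wp_repeat (I := I)); last first.
- by split=> //=; try lia; rewrite sub0r; split=> //; lia.
- by move=> s' [_ _ h [h1 h2]]; lia.
move=> n s' [cs' hso hc [hi hn HJ]].
apply: (step _ _ _ hi cs' erefl HJ) => s2 cs2 hi2 hc2 hso2 HJ2.
have [_ one2 _ _ _] := cs2.
rewrite /= one2 hi2 hc2 hc; do 2 (split; first by bounds).
case: ifP => h.
  by split=> //=; rewrite ?hso2 ?hi2 ?hc2 ?hc //; try lia; split=> //; lia.
apply: fin => //=; rewrite ?hso2 //.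
by have <- : rg s' rI + 1 = 15 * T%:Z by lia.
Qed.

Section Prefix.
Variables (c r : int -> nat -> int).
Hypothesis r_rec : forall i y, r i y = c i y + r (i - K) y.
Hypothesis r_low : forall i y, i < - T%:Z -> r i y = 0.
Hypothesis r_bound : forall i y, `|r i y| <= T%:Z.

Definition partial (i : int) (i' : int) (y : nat) : int :=
  if i' < i then r i' y else c i' y.

Lemma c_bound i y : `|c i y| <= 2 * T%:Z.
Proof. by have := r_rec i y; have := r_bound i y; have := r_bound (i - K) y; lia. Qed.

Lemma wp_prefix_row i (Q : state -> Prop) s :
  - T%:Z <= i < 15 * T%:Z -> consts s -> rg s rI = i -> holds_array (hp s) (partial i) ->
  (forall s', consts s' -> rg s' rI = i -> rg s' rCnt = rg s rCnt -> so s' = so s ->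
     holds_array (hp s') (partial (i + 1)) -> Q s') ->
  wp (prefix_row N) Q s.
Proof.
move=> hi cs hI ha HQ; have [z0 one hT hO [hK _ _ _]] := cs.
rewrite /prefix_row; move: wp_For => wpF; move EL: (For _ _) => L /=.
apply: wp_address => //=; rewrite hO hI; first by apply: address_bound; lia.
rewrite hK; split; first by rewrite /fits; lia.
apply: wp_address => //=; rewrite hO; first by apply: address_bound; lia.
rewrite -EL {L EL}.
pose F j i' y := if (i' == i) && (y < j)%N then r i' y else partial i i' y.
pose I j s' := [/\ consts s', rg s' rI = i, rg s' rCnt = rg s rCnt, so s' = so s &
  [/\ rg s' rP = addr i j, rg s' rQ = addr (i - K) j & holds_array (hp s') (F j)]].
have hi16 : - (16 * T%:Z) <= i by lia.
have hiK : - (16 * T%:Z) <= i - K by lia.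
apply: (wp_For (I := I)).
- split=> //=; split=> //; rewrite /addr ?addr0 //.
  by move=> i' y hi' hy; rewrite /F andbF ha.
- move=> j s' hj [cs' hI' hC' hso' [hP hQ ha']].
  have [_ one' _ _ _] := cs'.
  have gP := addr_ge j hi16.
  have gQ := addr_ge j hiK.
  have lP : addr i j < W%:Z by apply: addr_le => //; lia.
  have lQ : addr (i - K) j < W%:Z by apply: addr_le => //; lia.
  have aP : hp s' `|addr i j|%N = c i j.
    by rewrite ha' // /F ltnn andbF /partial ltxx.
  have aQ : hp s' `|addr (i - K) j|%N = r (i - K) j.
    rewrite ha' // /F; have -> : (i - K == i) = false by lia.
    by rewrite /partial /=; have -> : (i - K < i) by lia.
  have b1 := r_bound i j; have b2 := r_bound (i - K) j; have b3 := c_bound i j.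
  rewrite /= hP hQ aP aQ one'; split; first by lia.
  split; first by lia.
  rewrite -r_rec; split; first by rewrite /fits; lia.
  split; first by lia.
  do 2 (split; first by rewrite /fits; lia).
  split=> //=.
  split; [by rewrite addrS | by rewrite addrS |].
  apply: (holds_array_upd ha') => // i' y' hy'.
  rewrite /F ltnS leq_eqVlt.
  by case: eqP => [->|_] //=; case: eqP => [->|_].
- move=> s' [cs' hI' hC' hso' [hP hQ ha']].
  apply: HQ => // i' y hi' hy; rewrite ha' // /F hy andbT /partial.
  case: eqP => [->|ne]; first by have -> : (i < i + 1) by lia.
  by have -> : (i' < i + 1) = (i' < i) by lia.
Qed.

Lemma wp_prefix (Q : state -> Prop) s :
  consts s -> holds_array (hp s) c ->
  (forall s', consts s' -> so s' = so s ->
     (forall i y, i < 15 * T%:Z -> - (16 * T%:Z) <= i -> (y < width N)%N ->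
        hp s' `|addr i y|%N = r i y) -> Q s') ->
  wp (rows (prefix_row N)) Q s.
Proof.
move=> cs ha HQ; apply: (wp_rows (J := fun i h => holds_array h (partial i)) cs).
- move=> i y hi hy; rewrite ha // /partial; case: ifP => // h.
  by have := r_rec i y; rewrite !r_low //; lia.
- by move=> i s1 Q1 hi cs1 hI1 ha1 HQ1; apply: wp_prefix_row hi cs1 hI1 ha1 HQ1.
- move=> s' cs' hso' ha'; apply: HQ => // i y hi hi' hy.
  by rewrite ha' // /partial hi.
Qed.

End Prefix.

(** This bounds the number of passes of a reduction loop with step d. *)
Lemma steps_bound (m d v : nat) (a : int) :
  (0 < d)%N -> (`|a| <= v%:Z)%R -> (a + m%:Z * d%:Z < d%:Z)%R -> (m <= v)%N.
Proof.
case: m => // m d0 hv; rewrite -addn1 PoszD mulrDl mul1r => h.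
have : (m%:Z * 1 <= m%:Z * d%:Z)%R by apply: ler_wpM2l; lia.
lia.
Qed.

Section Normalize.
Variables (d : nat -> nat) (b : nat -> nat -> int) (M : nat).
(* Clearing one pivot multiplies the bound on the entries by at most g, so V
   bounds the entries of the normal forms, and G T the passes of a loop. *)
Let g := (1 + 5 * M)%N.
Let V := (T * g ^ N)%N.
Let G := (g ^ N + 4)%N.
Hypothesis b_bound : forall k y, (k < N)%N -> (y < N)%N -> `|b k y| <= M%:Z.
Hypothesis b_diag : forall k, b k k = (d k)%:Z.
Hypothesis b_upper : forall k y, (y < k)%N -> b k y = 0.
Hypothesis b_rel : forall k, lin (b k) = 0.
Hypothesis HV : (8 * V + 8 * M + 8 * T < W)%N.

Definition with_vector (q : int -> nat -> int) (i : int) (off : nat) (c : nat -> int)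
    (i' : int) (y : nat) : int :=
  if [&& i' == i, (off <= y)%N & (y < off + N)%N] then c (y - off)%N else q i' y.

Lemma eq_holds_array h f f' : holds_array h f -> (forall i y, (y < width N)%N -> f i y = f' i y) ->
  holds_array h f'.
Proof. by move=> hf e i y hi hy; rewrite hf ?e. Qed.

Lemma eq_with_vector q i off c c' i' y : (forall y, (y < N)%N -> c y = c' y) ->
  with_vector q i off c i' y = with_vector q i off c' i' y.
Proof.
move=> e; rewrite /with_vector; case: ifP => // /and3P[_ h1 h2].
by apply: e; lia.
Qed.

Lemma with_vector_upd q i off c j z i' y : (j < N)%N ->
  with_vector q i off (fun y => if y == j then z else c y) i' y =
  if (i' == i) && (y == off + j)%N then z else with_vector q i off c i' y.
Proof.
move=> hj; rewrite /with_vector; case: eqP => //= _.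
case: (eqVneq y (off + j)%N) => [->|ne].
  by rewrite leq_addr ltn_add2l hj addKn eqxx.
case: ifP => // /andP[h1 h2]; have -> : (y - off == j)%N = false by lia.
by [].
Qed.

Section Row.
Variables (q : int -> nat -> int) (i : int) (off : nat).
Hypothesis hi : - T%:Z <= i < 15 * T%:Z.
Hypothesis hoff : (off + N <= width N)%N.

Let hi16 : - (16 * T%:Z) <= i. Proof. lia. Qed.

Definition vec_at (s : state) (c : nat -> int) : Prop :=
  [/\ consts s, rg s rP = addr i off & holds_array (hp s) (with_vector q i off c)].

Lemma vec_at_setr s c r z :
  r \notin [:: rZero; rOne; rT; rO; rK; rKu; rSg; rNeq; rP] -> vec_at s c ->
  vec_at (setr s r z) c.
Proof.
move=> hr [cs hP ha]; split=> //; last by case: r hr.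
by apply: consts_setr => //; case: r hr.
Qed.

Lemma cell_ok j : (j < N)%N ->
  nregs%:Z <= addr i (off + j) /\ bnd (addr i (off + j)).
Proof.
move=> hj; have := addr_ge (off + j) hi16.
have : addr i (off + j) < W%:Z by apply: addr_le; lia.
by rewrite /fits; lia.
Qed.

Lemma vec_at_cell s c j : (j < N)%N -> vec_at s c ->
  hp s `|addr i (off + j)%N|%N = c j.
Proof.
move=> hj [_ _ ha]; rewrite ha //; last by lia.
by rewrite /with_vector eqxx leq_addr ltn_add2l hj addKn.
Qed.

Lemma addr_off j : addr i off + j%:Z = addr i (off + j).
Proof. by rewrite /addr PoszD addrA. Qed.

Lemma wp_add_multiple z k c (Q : state -> Prop) s :
  (k < N)%N -> `|z| <= 1 -> vec_at s c ->
  (forall y, (y < N)%N -> bnd (c y + z * b k y)) ->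
  (forall s', changes_only [:: rQ; rA; rB; rTmp] s s' -> so s' = so s ->
     vec_at s' (fun y => c y + z * b k y) -> Q s') ->
  wp (add_multiple N b z k) Q s.
Proof.
move=> hk hz va hb HQ.
pose C j y := if (y < j)%N then c y + z * b k y else c y.
pose I j s' := [/\ changes_only [:: rQ; rA; rB; rTmp] s s', so s' = so s & vec_at s' (C j)].
apply: (wp_For (I := I)); first by split.
- move=> j s' hj [cl hso va'].
  have [g1 g2] := cell_ok hj; have [_ hP _] := va'; have vc := vec_at_cell hj va'.
  have cj : C j j = c j by rewrite /C ltnn.
  have zb : `|z * b k j| <= M%:Z.
    rewrite normrM; have := b_bound hk hj; have := normr_ge0 (b k j); nia.
  rewrite /= hP addr_off vc cj; split; first by rewrite /fits; lia.
  split; first by [].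
  split; first by [].
  split; first by rewrite /fits; lia.
  split; first by apply: hb.
  split; first by [].
  split=> //; first by track_changes.
  have [cs' _ ha'] := va'; split=> //=.
  apply: (holds_array_upd ha') => //; first by lia.
  move=> i' y' hy'; rewrite -with_vector_upd //; apply: eq_with_vector => y hy.
  by rewrite /C ltnS leq_eqVlt; case: eqP => [->|].
- move=> s' [cl hso [cs' hP' ha']]; apply: HQ => //; split=> //.
  apply: (eq_holds_array ha') => i' y hy; apply: eq_with_vector => y' hy'.
  by rewrite /C hy'.
Qed.

Lemma wp_reduce k c (v : nat) (Q : state -> Prop) s :
  (k < N)%N -> vec_at s c -> (forall y, (y < N)%N -> `|c y| <= v%:Z) ->
  (0 < v)%N -> (v * g <= V)%N -> (v + 4 <= G * T)%N ->
  (forall s' z, changes_only [:: rQ; rA; rB; rX; rTmp] s s' -> so s' = so s ->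
     vec_at s' (fun y => c y + z * b k y) ->
     ((0 < d k)%N -> 0 <= c k + z * b k k < (d k)%:Z) ->
     (forall y, (y < N)%N -> `|c y + z * b k y| <= (v * g)%:Z) -> Q s') ->
  wp (reduce N d b G k) Q s.
Proof.
move=> hk va hc v0 vg vG HQ; rewrite /reduce.
have vgE : (v * g = v + 5 * (v * M))%N by rewrite /g; lia.
case dk: (d k) => [|d'].
  apply: (HQ s 0) => //; last 2 first.
  - by rewrite dk.
  - by move=> y hy; rewrite mul0r addr0; have := hc y hy; lia.
  have [cs hP ha] := va; split=> //; apply: (eq_holds_array ha) => i' y' _.
  by apply: eq_with_vector => y _; rewrite mul0r addr0.
have d0 : (0 < d k)%N by rewrite dk.
rewrite -{}dk; clear d'.
have dM : ((d k)%:Z <= M%:Z) by have := b_bound hk hk; rewrite b_diag; lia.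
have ck := hc k hk.
pose L := [:: rQ; rA; rB; rX; rTmp].
pose cm (m : int) y := c y + m * b k y.
(* At most v + 1 additions and v + 2 subtractions take place. *)
have cm_bound (m : int) (e : nat) y : (y < N)%N -> `|m| <= e%:Z -> (e <= 3 * v + 2)%N ->
    `|cm m y| <= (v * g)%:Z.
  move=> hy hm he; have h1 := hc y hy; have h2 := b_bound hk hy.
  have : `|m * b k y| <= (3 * v + 2)%:Z * M%:Z.
    rewrite normrM; apply: ler_pM => //; lia.
  rewrite /cm vgE; have : (M <= v * M)%N by rewrite leq_pmull.
  lia.
have cmS m : (fun y => cm m y + 1 * b k y) = cm (m + 1).
  by apply: funext => y; rewrite /cm; ring.
have cmP m : (fun y => cm m y + - 1 * b k y) = cm (m - 1).
  by apply: funext => y; rewrite /cm; ring.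
have cmk m : cm m k = c k + m * (d k)%:Z by rewrite /cm b_diag.
pose subtractions := (Repeat (fun T => G * T)%N rX
  (add_multiple N b (- 1) k;; get_entry k;; Const rTmp (d k)%:Z;; Minus rX rA rTmp;;
   Incr rX))%cmd.
                                                                     
(* The second loop is entered with an entry that is at least d k. *)
have loop2 m1 s1 : changes_only L s s1 -> so s1 = so s -> vec_at s1 (cm m1) ->
    0 <= m1 <= (v + 1)%:Z -> (d k)%:Z <= cm m1 k <= v%:Z + 2 * (d k)%:Z ->
    wp subtractions Q s1.
  move=> cl1 hso1 va1 hm1 hd1.
  have m_bound (m : nat) : (d k)%:Z <= cm (m1 - m%:Z) k -> (m <= v.+1)%N.
    move=> hm; apply: (@steps_bound m (d k) v.+1 (- v.+1%:Z)) => //.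
    by move: hd1 hm; rewrite !cmk mulrBl; lia.
  pose I n s' := exists m : nat, [/\ changes_only L s s', so s' = so s,
    vec_at s' (cm (m1 - m%:Z)), (n + m = G * T)%N & (d k)%:Z <= cm (m1 - m%:Z) k].
  apply: (wp_repeat (I := I)); last first.
  - by exists 0%N; rewrite subr0 addn0; split=> //; lia.
  - by move=> s' [m [_ _ _ hm /m_bound]]; lia.
  move=> n s' [m [cl hso va' hm hd]].
  have mv := m_bound _ hd.
  have hb y : (y < N)%N -> `|cm (m1 - m%:Z - 1) y| <= (v * g)%:Z.
    by move=> hy; apply: (cm_bound _ (v + 2)%N) => //; lia.
  rewrite wp_seq; apply: (wp_add_multiple hk _ va') => //.
    move=> y hy; have := hb y hy; rewrite -cmP /fits; lia.
  rewrite cmP => s2 cl2 hso2 va2; have [[_ one2 _ _ _] hP2 _] := va2.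
  have [g1 g2] := cell_ok hk; have vc := vec_at_cell hk va2.
  rewrite wp_seq /= hP2 addr_off vc one2; split; first by rewrite /fits; lia.
  split; first by [].
  split; first by [].
  split; first by rewrite /fits; lia.
  have hbk := hb k hk.
  split; first by rewrite /fits; lia.
  split; first by rewrite /fits; lia.
  have cl3 : changes_only L s s2.
    apply: changes_only_trans cl _; apply: changes_only_sub cl2 => r.
    by rewrite !inE => /or4P[] ->; rewrite ?orbT.
  have em : m1 - m%:Z - 1 = m1 - m.+1%:Z by lia.
  rewrite em in vc va2 hbk hb *.
  case: ifP => hlt.
    exists m.+1; split=> //; first by track_changes.
    - by rewrite /= hso2.
    - by rewrite -hm addSnnS.
    - by lia.
  apply: (HQ _ (m1 - m.+1%:Z)) => //.
  - by track_changes.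
  - by rewrite /= hso2.
  - move=> _; rewrite b_diag -cmk; apply/andP; split; last by lia.
    move: hd; rewrite !cmk; have -> : m.+1%:Z = m%:Z + 1 by lia.
    by rewrite !mulrBl mulrDl; lia.
pose I n s' := exists m : nat, [/\ changes_only L s s', so s' = so s, vec_at s' (cm m%:Z),
  (n + m = G * T)%N & m = 0%N \/ cm m%:Z k < (d k)%:Z].
rewrite wp_seq -/subtractions; move: subtractions loop2 => subtractions loop2.
apply: (wp_repeat (I := I)); last first.
- exists 0%N; split=> //; last by left.
    have [cs hP ha] := va; split=> //; apply: (eq_holds_array ha) => i' y' _.
    by apply: eq_with_vector => y _; rewrite /cm mul0r addr0.
  by rewrite addn0.
- move=> s' [m [_ _ _ hm hd]]; rewrite add0n in hm.
  have [m0|hlt] : m = 0%N \/ cm m k < (d k)%:Z by [].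
    by lia.
  by rewrite cmk in hlt; have := steps_bound d0 ck hlt; lia.
move=> n s' [m [cl hso va' hm hd]].
have mv : (m <= v)%N.
  by case: hd => [->|] //; rewrite cmk; apply: steps_bound.
have hb y : (y < N)%N -> `|cm (m%:Z + 1) y| <= (v * g)%:Z.
  by move=> hy; apply: (cm_bound _ (m + 1)%N) => //; lia.
rewrite wp_seq; apply: (wp_add_multiple hk _ va') => //.
  move=> y hy; have := hb y hy; rewrite -cmS /fits; lia.
rewrite cmS => s2 cl2 hso2 va2; have [_ hP2 _] := va2.
have [g1 g2] := cell_ok hk; have vc := vec_at_cell hk va2.
rewrite wp_seq /= hP2 addr_off vc; split; first by rewrite /fits; lia.
split; first by [].
split; first by [].
split; first by rewrite /fits; lia.
have hbk := hb k hk.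
split; first by rewrite /fits; lia.
have cl3 : changes_only L s s2.
  apply: changes_only_trans cl _; apply: changes_only_sub cl2 => r.
  by rewrite !inE => /or4P[] ->; rewrite ?orbT.
case: ifP => hlt.
  exists m.+1; split=> //; first by track_changes.
  - by rewrite /= hso2.
  - have -> : m.+1%:Z = m%:Z + 1 by lia.
    by do 5 (apply: vec_at_setr; first by []).
  - by rewrite -hm addSnnS.
  - right; have -> : m.+1%:Z = m%:Z + 1 by lia.
    by move: hlt; rewrite subr_gt0.
apply: loop2 => //.
- by track_changes.
- by rewrite /= hso2.
- by do 5 (apply: vec_at_setr; first by []); apply: va2.
- by lia.
- apply/andP; split; first by lia.
  rewrite cmk in hlt *; case: hd => [m0|]; last by rewrite cmk; lia.
  by rewrite m0; lia.
Qed.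

Lemma wp_reduce_all c (Q : state -> Prop) s :
  vec_at s c -> (forall y, (y < N)%N -> `|c y| <= T%:Z) ->
  (forall s' c', changes_only [:: rQ; rA; rB; rX; rTmp] s s' -> so s' = so s ->
     vec_at s' c' -> lin c' = lin c -> normal N d c' ->
     (forall y, (y < N)%N -> `|c' y| <= V%:Z) -> Q s') ->
  wp (For N (reduce N d b G)) Q s.
Proof.
move=> va hc HQ.
pose I k s' := exists c', [/\ changes_only [:: rQ; rA; rB; rX; rTmp] s s', so s' = so s,
  vec_at s' c', lin c' = lin c &
  (forall j, (j < k)%N -> (0 < d j)%N -> 0 <= c' j < (d j)%:Z) /\
  (forall y, (y < N)%N -> `|c' y| <= (T * g ^ k)%:Z)].
have g0 : (0 < g)%N by rewrite /g; lia.
apply: (wp_For (I := I)).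
- by exists c; split=> //; split=> // y hy; rewrite muln1; apply: hc.
- move=> k s' hk [c' [cl hso va' hl [hn hb]]].
  have gk : (g ^ k * g <= g ^ N)%N by rewrite -expnSr leq_pexp2l.
  have gk0 : (0 < g ^ k)%N by rewrite expn_gt0 g0.
  have gk1 : (g ^ k <= g ^ k * g)%N by rewrite leq_pmulr.
  apply: (wp_reduce hk va' hb) => //.
  + by rewrite muln_gt0 T0.
  + by rewrite -mulnA leq_mul2l gk orbT.
  + rewrite /G mulnDl [(g ^ N * T)%N]mulnC leq_add //; last by lia.
    by rewrite leq_mul2l (leq_trans gk1) ?orbT.
  move=> s2 z cl2 hso2 va2 hd2 hb2; exists (fun y => c' y + z * b k y).
  split=> //; first by apply: changes_only_trans cl cl2.
  + by rewrite hso2.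
  + by rewrite linD linM b_rel mul0rz addr0.
  split; last by move=> y hy; rewrite expnSr mulnA; apply: hb2.
  move=> j; rewrite ltnS leq_eqVlt => /orP[/eqP -> /hd2 //|jk hdj].
  by rewrite b_upper // mulr0 addr0; apply: hn.
- move=> s' [c' [cl hso va' hl [hn hb]]]; apply: HQ cl hso va' hl _ hb.
  by move=> j jN dj; apply: hn.
Qed.

End Row.

Definition normal_form_of (c c0 : nat -> int) : Prop :=
  [/\ lin c = lin c0, normal N d c & forall y, (y < N)%N -> `|c y| <= V%:Z].

Variable r : int -> nat -> int.
Hypothesis r_bound : forall i y, `|r i y| <= T%:Z.
Hypothesis r_low : forall i y, i < - T%:Z -> r i y = 0.

Definition normal_row (q : int -> nat -> int) (i : int) : Prop :=
  normal_form_of (q i) (r i) /\ normal_form_of (fun y => q i (N + y)%N) (fun y => r i (N + y)%N).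

Definition normalized_below (i : int) (h : nat -> int) : Prop :=
  exists q, [/\ holds_array h q, forall i', i' < i -> normal_row q i' &
    forall i' y, i <= i' < 15 * T%:Z -> q i' y = r i' y].

Lemma eq_normal_form_of c c' c0 : (forall y, (y < N)%N -> c y = c' y) ->
  normal_form_of c c0 -> normal_form_of c' c0.
Proof.
move=> e [h1 h2 h3]; split; first by rewrite -h1; apply: eq_lin => y hy; rewrite e.
  by move=> j hj dj; rewrite -e //; apply: h2.
by move=> y hy; rewrite -e //; apply: h3.
Qed.

Lemma wp_normalize_row i (Q : state -> Prop) s :
  - T%:Z <= i < 15 * T%:Z -> consts s -> rg s rI = i -> normalized_below i (hp s) ->
  (forall s', consts s' -> rg s' rI = i -> rg s' rCnt = rg s rCnt -> so s' = so s ->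
     normalized_below (i + 1) (hp s') -> Q s') ->
  wp (normalize_row N d b G) Q s.
Proof.
move=> hi cs hI [q [ha ht hq]] HQ; have [z0 one hT hO [hK _ _ _]] := cs.
have hN : (N + N <= width N)%N by rewrite /width addnn.
have hN0 : (0 + N <= width N)%N by rewrite add0n (leq_trans _ hN) // leq_addr.
pose c := q i.
rewrite /normalize_row; move E: (For N _) => L /=; apply: wp_address => //=.
  by rewrite hO hI; apply: address_bound; lia.
rewrite hO hI -E; apply: (@wp_reduce_all q i 0 hi hN0 c) => //.
- split=> //=; first by rewrite /addr addr0.
  apply: (eq_holds_array ha) => i' y' _; rewrite /with_vector add0n subn0 /=.
  by case: eqP => [->|] //=; case: ifP.
- by move=> y hy; rewrite /c hq //; lia.
move=> s1 c1 cl1 hso1 va1 l1 n1 b1; have [cs1 hP1 ha1] := va1.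
split; first by rewrite /fits; lia.
have lN := addr_le.
have aN : addr i 0 + N%:Z = addr i N by rewrite /addr addr0.
have gN := addr_ge N (i := i).
have lN' : addr i N < W%:Z by apply: lN; lia.
rewrite hP1 aN; split; first by rewrite /fits; lia.
pose q1 := with_vector q i 0 c1.
apply: (@wp_reduce_all q1 i N hi hN (fun y => q i (N + y)%N)) => //.
- split=> //=.
  apply: (eq_holds_array ha1) => i' y' _; rewrite /with_vector /q1 /with_vector.
  case: eqP => [->|] //=; case: (leqP N y') => hy //=.
  by case: ifP => //; rewrite subnKC.
- by move=> y hy; rewrite hq //; lia.
move=> s2 c2 cl2 hso2 va2 l2 n2 b2; have [cs2 hP2 ha2] := va2.
have hclo r' : r' \in [:: rI; rCnt] -> rg s2 r' = rg s r'.
  by rewrite !inE => /orP[] /eqP ->; rewrite cl2 //= cl1.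
apply: HQ => //.
- by rewrite hclo.
- by rewrite hclo.
- by rewrite hso2 /= hso1.
exists (with_vector q1 i N c2); split=> //.
- move=> i' hi'; case: (eqVneq i' i) => [->|ne].
    split; [apply: (eq_normal_form_of (c := c1)) |
      apply: (eq_normal_form_of (c := c2))] => [y hy| |y hy|].
    + by rewrite /with_vector eqxx leqNgt hy /= /q1 /with_vector eqxx add0n hy subn0.
    + by split=> //; rewrite l1; apply: eq_lin => y hy; rewrite /c hq //; lia.
    + by rewrite /with_vector eqxx leq_addr ltn_add2l hy addKn.
    + by split=> //; rewrite l2; apply: eq_lin => y hy; rewrite hq //; lia.
  have e y : with_vector q1 i N c2 i' y = q i' y.
    by rewrite /with_vector (negPf ne) /= /q1 /with_vector (negPf ne).
  have [t1 t2] : normal_row q i' by apply: ht; lia.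
  by split; [apply: eq_normal_form_of t1 | apply: eq_normal_form_of t2] => y hy; rewrite e.
- move=> i' y hi'; have ne : (i' == i) = false by lia.
  by rewrite /with_vector ne /= /q1 /with_vector ne /= hq //; lia.
Qed.

Lemma wp_normalize (Q : state -> Prop) s :
  consts s ->
  (forall i y, i < 15 * T%:Z -> - (16 * T%:Z) <= i -> (y < width N)%N ->
        hp s `|addr i y|%N = r i y) ->
  (forall s' q, consts s' -> so s' = so s -> holds_array (hp s') q ->
     (forall i, i < 15 * T%:Z -> normal_row q i) -> Q s') ->
  wp (rows (normalize_row N d b G)) Q s.
Proof.
move=> cs hs HQ; apply: (wp_rows (J := normalized_below) cs).
- exists (fun i y => if i < 15 * T%:Z then r i y else hp s `|addr i y|%N).
  split.
  + by move=> i y hi hy; case: ifP => // h; rewrite hs.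
  + move=> i hi; have z y : r i y = 0 by apply: r_low.
    have t0 (f : nat -> int) : (forall y, f y = 0) -> normal_form_of (fun=> 0) f.
      move=> f0; split=> //; first by apply: eq_lin => y _; rewrite f0.
    have lt15 : i < 15 * T%:Z by lia.
    split; rewrite lt15; [apply: (eq_normal_form_of (c := fun=> 0)) |
      apply: (eq_normal_form_of (c := fun=> 0))];
      try (by apply: t0 => y; rewrite z).
    * by move=> y _; rewrite z.
    * by move=> y _; rewrite z.
  + by move=> i y hi; rewrite ifT //; lia.
- by move=> i s1 Q1 hi cs1 hI1 HJ HQ1; apply: (wp_normalize_row hi).
- move=> s' cs' hso' [q [ha ht _]]; exact: HQ cs' hso' ha ht.
Qed.

End Normalize.

Section Search.
Variable V : nat.
Hypothesis HV : (8 * V + 8 * T < W)%N.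
Hypothesis Hku : `|ku| < T%:Z.
Hypothesis Hnq : nq = 0 \/ nq = 1.

Variable q : int -> nat -> int.
Hypothesis q_bound : forall i y, i < 15 * T%:Z -> (y < width N)%N -> `|q i y| <= V%:Z.

Lemma wp_locate i m (Q : state -> Prop) s :
  consts s -> rg s rI = i -> rg s rM = m ->
  - (16 * T%:Z) <= i <= 16 * T%:Z -> - (16 * T%:Z) <= i - m <= 16 * T%:Z ->
  (forall s', changes_only [:: rP; rQ; rJ; rTmp] s s' -> hp s' = hp s -> so s' = so s ->
     rg s' rP = addr i N -> rg s' rQ = addr (i - m) 0 -> Q s') ->
  wp (locate N) Q s.
Proof.
move=> cs hI hM hi him HQ; have [z0 one hT hO _] := cs.
rewrite /locate wp_seq; apply: wp_address => //=.
  by rewrite hO hI; apply: address_bound.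
have NS : (N <= width N)%N by rewrite /width -addnn leq_addr.
have g1 : nregs%:Z + T%:Z <= addr i N by apply: addr_ge; lia.
have l1 : addr i N < W%:Z by apply: addr_le => //; lia.
have e1 : O + (width N)%:Z * i + N%:Z = addr i N by [].
rewrite hO hI hM e1; split; first by rewrite /fits; lia.
split; first by rewrite /fits; lia.
split; first by rewrite /fits; lia.
apply: wp_address => //=.
  by rewrite hO; apply: address_bound.
by apply: HQ => //=; [track_changes | rewrite /addr hO addr0].
Qed.
Opaque locate.

Definition entry (m i : int) (y : nat) : int := q i (N + y)%N - q (i - m) y.

(** Truth is encoded by 0, because mismatches set the register. *)
Definition flag (s : state) (r : reg) (P : Prop) : Prop :=
  (rg s r = 0 /\ P) \/ (rg s r = 1 /\ ~ P).

Lemma flag_iff s r P P' : (P <-> P') -> flag s r P -> flag s r P'.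
Proof. by rewrite /flag => -[h h'] [[e p]|[e p]]; [left|right]; split; auto. Qed.

Definition matching_shift (m : int) : Prop :=
  nq = 0 /\ forall i y, 3 * T%:Z <= i < 3 * T%:Z + K -> (y < N)%N -> entry m i y = 0.

Section Shift.
Variables (m : int) (h : nat -> int).
Hypothesis hm : - (2 * T%:Z) <= m < 2 * T%:Z.
Hypothesis hh : holds_array h q.

Lemma cells_at i j : - (3 * T%:Z) <= i < 3 * T%:Z + K -> (j < N)%N ->
  [/\ nregs%:Z <= addr i (N + j), nregs%:Z <= addr (i - m) j,
    bnd (addr i (N + j) + 1), bnd (addr (i - m) j + 1) &
    [/\ h `|addr i (N + j)%N|%N = q i (N + j)%N, h `|addr (i - m) j|%N = q (i - m) j &
       `|entry m i j| <= 2 * V%:Z]].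
Proof.
move=> hi hj; have w : (N + j < width N)%N by rewrite /width -addnn ltn_add2l.
have w' : (j < width N)%N by apply: leq_trans w; rewrite ltnS leq_addl.
have g1 : nregs%:Z + T%:Z <= addr i (N + j) by apply: addr_ge; lia.
have g2 : nregs%:Z + T%:Z <= addr (i - m) j by apply: addr_ge; lia.
have l1 : addr i (N + j).+1 < W%:Z by apply: addr_le => //; lia.
have l2 : addr (i - m) j.+1 < W%:Z by apply: addr_le => //; lia.
move: l1 l2 g1 g2; rewrite /fits -!addrS.
move=> l1 l2 g1 g2; split; try by lia.
split; [by apply: hh => //; lia | by apply: hh => //; lia |].
apply: le_trans (ler_normB _ _) _; have -> : 2 * V%:Z = V%:Z + V%:Z by lia.
by apply: lerD; apply: q_bound => //; lia.
Qed.

Definition scan (s0 s : state) (i : int) : Prop :=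
  [/\ changes_only [:: rX; rI; rInner; rP; rQ; rJ; rTmp; rA; rB] s0 s, hp s = h, so s = so s0,
    rg s rI = i & rg s rInner = 3 * T%:Z + K - i].

Lemma wp_compare s0 s i (Q : state -> Prop) (P : Prop) :
  consts s0 -> rg s0 rM = m -> 3 * T%:Z <= i < 3 * T%:Z + K -> scan s0 s i ->
  flag s rX P ->
  (forall s', scan s0 s' (i + 1) ->
     flag s' rX (P /\ forall y, (y < N)%N -> entry m i y = 0) -> Q s') ->
  wp (locate N;;
     For N (fun=> Get rB rP;; Get rA rQ;; Minus rA rB rA;;
                  IfPos rA (Const rX 1);; IfNeg rA (Const rX 1);;
                  Incr rP;; Incr rQ);;
     Incr rI;; Decr rInner)%cmd Q s.
Proof.
move=> cs0 hM hi [cl hhp hso hI hIn] fl HQ.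
have cs : consts s by apply: consts_changes_only cl _ cs0.
rewrite wp_seq; apply: (wp_locate cs hI (m := m)); try by lia.
  by rewrite cl.
move=> s1 cl1 hp1 so1 hP1 hQ1.
pose L := [:: rX; rI; rInner; rP; rQ; rJ; rTmp; rA; rB].
pose I j s' := [/\ changes_only L s0 s', hp s' = h, so s' = so s0, rg s' rI = i &
  [/\ rg s' rInner = 3 * T%:Z + K - i, rg s' rP = addr i (N + j),
     rg s' rQ = addr (i - m) j & flag s' rX (P /\ forall y, (y < j)%N -> entry m i y = 0)]].
rewrite wp_seq; apply: (wp_For (I := I)).
- split; rewrite ?hp1 ?so1 ?addn0 //.
  + apply: changes_only_trans cl _; apply: changes_only_sub cl1 => r.
    by rewrite !inE => /or4P[] /eqP ->.
  + by rewrite cl1.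
  + split=> //; first by rewrite cl1.
  by apply: (flag_iff (P := P)); [split=> [p|[]] | rewrite /flag cl1].
- move=> j s' hj [cl' hhp' hso' hI' [hIn' hP' hQ' fl']].
  have hi' : - (3 * T%:Z) <= i < 3 * T%:Z + K by lia.
  have [g1 g2 b1 b2 [v1 v2 eb]] := cells_at hi' hj.
  have cs' : consts s' by apply: consts_changes_only cl' _ cs0.
  have [z0 one _ _ _] := cs'.
  rewrite /= hP' hhp' v1 hQ' v2; split; first by [].
  split; first by [].
  rewrite -/(entry m i j).
  split; first by rewrite /fits; lia.
  have fin s2 : changes_only L s' s2 -> hp s2 = h -> so s2 = so s' -> rg s2 rI = i ->
      rg s2 rInner = rg s' rInner -> rg s2 rP = addr i (N + j) + 1 ->
      rg s2 rQ = addr (i - m) j + 1 ->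
      (rg s2 rX = if entry m i j == 0 then rg s' rX else 1) -> I j.+1 s2.
    move=> clS hpS soS iS nS pS qS xS; split=> //; first by apply: changes_only_trans cl' clS.
      by rewrite soS.
    split; rewrite ?nS ?pS ?qS ?addrS ?addnS //.
    have allS : (forall y, (y < j.+1)%N -> entry m i y = 0) <->
        (forall y, (y < j)%N -> entry m i y = 0) /\ entry m i j = 0.
      split=> [a|[a e] y]; first by split=> [y yj|]; apply: a => //; apply: ltnW.
      by rewrite ltnS leq_eqVlt => /orP[/eqP -> //|]; apply: a.
    move: xS; case: eqP => e xS.
      by case: fl' => -[x1 x2]; [left|right]; rewrite xS; split=> //; tauto.
    by right; split=> //; tauto.
  have eS (z : int) : 0 < z \/ z < 0 -> (z == 0) = false by lia.
  apply: wp_ifpos => //=; first by rewrite /fits; lia.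
    move=> pos; split; first by rewrite /fits; lia.
    apply: wp_ifneg => //=; [by rewrite /fits; lia | by lia |] => _.
    rewrite hP' hQ' one; do 2 (split; first by []).
    by apply: fin => //=; [track_changes | rewrite eS //; left].
  move=> npos; apply: wp_ifneg => //=; first by rewrite /fits; lia.
    move=> neg; split; first by rewrite /fits; lia.
    rewrite hP' hQ' one; do 2 (split; first by []).
    by apply: fin => //=; [track_changes | rewrite eS //; right].
  move=> nneg; rewrite hP' hQ' one; do 2 (split; first by []).
  by apply: fin => //=; [track_changes | have -> : entry m i j = 0 by lia].
- move=> s' [cl' hhp' hso' hI' [hIn' hP' hQ' fl']].
  have cs' : consts s' by apply: consts_changes_only cl' _ cs0.
  have [z0 one _ _ _] := cs'.
  rewrite /= one hI' hIn'; split; first by rewrite /fits; lia.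
  split; first by rewrite /fits; lia.
  apply: HQ; last by [].
  split=> //=; [by track_changes | lia].
Qed.

Lemma wp_try_shift (Q : state -> Prop) s :
  consts s -> rg s rM = m -> hp s = h ->
  (forall s', changes_only [:: rX; rI; rInner; rP; rQ; rJ; rTmp; rA; rB; rFound; rRes] s s' ->
     hp s' = h -> so s' = so s ->
     (matching_shift m /\ rg s' rFound = 1 /\ rg s' rRes = m) \/
     (~ matching_shift m /\ rg s' rFound = rg s rFound /\ rg s' rRes = rg s rRes) -> Q s') ->
  wp (try_shift N) Q s.
Proof.
move=> cs hM hhp HQ; have [z0 one hT hO [hK _ _ hnq]] := cs.
rewrite /try_shift; move E: (Repeat _ _ _) => L /=; rewrite z0 hT hK hnq !addr0.
have nq_b : bnd nq by rewrite /fits; case: Hnq => ->; lia.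
do 4 (split; first by rewrite /fits; lia); rewrite -{}E; set s0 := setr _ rInner K.
pose so_far i := nq = 0 /\ forall i' y, 3 * T%:Z <= i' < i -> (y < N)%N -> entry m i' y = 0.
have cs0 : consts s0 by track_consts.
pose I n s' := exists i, [/\ scan s0 s' i, 3 * T%:Z <= i < 3 * T%:Z + K,
  3 * T%:Z + K - i <= n%:Z & flag s' rX (so_far i)].
apply: (wp_repeat (I := I)); last first.
- exists (3 * T%:Z); split; try by lia.
    by split=> //=; [lia | lia].
  rewrite /flag /=; case: Hnq => e; [left | right]; split=> //.
    by split=> // i' y; lia.
  by rewrite /so_far e => -[].
- by move=> s' [i [_ h1 h2 _]]; lia.
move=> n s' [i [sc hi hn fl]].
apply: (wp_compare cs0 hM hi sc fl) => s2 sc2 fl2.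
have fl3 : flag s2 rX (so_far (i + 1)).
  apply: flag_iff fl2; split=> [[[e a] a'] | [e a]].
    split=> // i' y hi' hy; case: (eqVneq i' i) => [->|ne]; first exact: a'.
    by apply: a => //; lia.
  split; first by split=> // i' y hi' hy; apply: a => //; lia.
  by move=> y hy; apply: a => //; lia.
have [cl2 hhp2 hso2 hI2 hIn2] := sc2.
case: ifP => hlt; first by exists (i + 1); split=> //; lia.
have fl4 : flag s2 rX (matching_shift m).
  have e : i + 1 = 3 * T%:Z + K by lia.
  by rewrite e in fl3.
have hM2 : rg s2 rM = m by rewrite cl2.
have z2 : rg s2 rZero = 0 by rewrite cl2.
have cl3 : changes_only [:: rX; rI; rInner; rP; rQ; rJ; rTmp; rA; rB; rFound; rRes] s s2.
  apply: (changes_only_trans (s2 := s0)); first by rewrite /s0; track_changes.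
  apply: changes_only_sub cl2 => r; rewrite !inE.
  by case/or4P => [->|->|->|/or4P[->|->|->|/or3P[] ->]]; rewrite ?orbT.
rewrite /= hM2 z2 addr0; case: fl4 => -[-> hg] /=.
  do 2 (split; first by rewrite /fits; lia).
  by apply: HQ => //=; [track_changes | left].
apply: HQ => //; right; split=> //.
by rewrite !cl2.
Qed.

End Shift.

Definition found (s : state) (hi : int) : Prop :=
  (rg s rFound = 0 /\ forall m, - (2 * T%:Z) <= m < hi -> ~ matching_shift m) \/
  [/\ rg s rFound = 1, - (2 * T%:Z) <= rg s rRes < 2 * T%:Z & matching_shift (rg s rRes)].

Lemma wp_search (Q : state -> Prop) s :
  consts s -> holds_array (hp s) q ->
  (forall s', consts s' -> hp s' = hp s -> so s' = so s -> found s' (2 * T%:Z) -> Q s') ->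
  wp (search N) Q s.
Proof.
move=> cs ha HQ; have [z0 one hT hO [hK _ _ hnq]] := cs.
rewrite /search; move E: (Repeat _ _ _) => L /=; rewrite z0 hT.
do 4 (split; first by rewrite /fits; lia); rewrite -{}E; set s0 := setr _ rCnt _.
pose I n s' := [/\ consts s', hp s' = hp s, so s' = so s, found s' (rg s' rM) &
  [/\ - (2 * T%:Z) <= rg s' rM < 2 * T%:Z, rg s' rCnt = 2 * T%:Z - rg s' rM &
     rg s' rCnt <= n%:Z]].
apply: (wp_repeat (I := I)); last first.
- split=> //=; first by left; split=> // m; lia.
  by split=> //=; lia.
- by move=> s' [_ _ _ _ [h1 h2 h3]]; lia.
move=> n s' [cs' hhp hso fd [h1 h2 h3]].
rewrite -hhp in ha.
rewrite wp_seq; apply: (wp_try_shift h1 ha cs' erefl erefl) => s2 cl2 hhp2 hso2 res.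
have cs2 : consts s2 by apply: consts_changes_only cl2 _ cs'.
have [_ one2 _ _ _] := cs2.
have hM2 : rg s2 rM = rg s' rM by rewrite cl2.
have hC2 : rg s2 rCnt = rg s' rCnt by rewrite cl2.
have fd2 : found s2 (rg s' rM + 1).
  case: res => -[g [e1 e2]]; first by right; rewrite e1 e2.
  case: fd => [[e a]|[e a b]]; last by right; rewrite e1 e2.
  left; rewrite e1; split=> // m hm; case: (eqVneq m (rg s' rM)) => [-> //|ne].
  by apply: a; lia.
rewrite /= one2 hM2 hC2; do 2 (split; first by rewrite /fits; lia).
case: ifP => hlt.
  split=> //=; rewrite ?hhp2 ?hso2 ?hM2 ?hC2 //.
  by split=> //=; lia.
apply: HQ => //=; rewrite ?hhp2 ?hso2 //.
by have <- : rg s' rM + 1 = 2 * T%:Z by lia.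
Qed.

Definition printed_row (m i : int) : seq int := [seq entry m i y | y <- iota 0 N].

Definition printed (m : int) : seq int :=
  1 :: m :: (- (3 * T%:Z) + if ku < 0 then K else 0) ::
  flatten [seq printed_row m (- (3 * T%:Z) + j%:Z) | j <- iota 0 (6 * T + `|K|)].

Lemma wp_print_rows m h pre (Q : state -> Prop) s0 :
  - (2 * T%:Z) <= m < 2 * T%:Z -> holds_array h q -> consts s0 -> hp s0 = h ->
  so s0 = pre -> rg s0 rM = m -> rg s0 rI = - (3 * T%:Z) ->
  rg s0 rInner = 6 * T%:Z + K ->
  (forall s, so s = pre ++ flatten
     [seq printed_row m (- (3 * T%:Z) + j%:Z) | j <- iota 0 (6 * T + `|K|)] -> Q s) ->
  wp (Repeat (fun T => 14 * T)%N rInner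
    (locate N;;
     For N (fun=> Get rB rP;; Get rA rQ;; Minus rA rB rA;; Emit rA;;
                  Incr rP;; Incr rQ);;
     Incr rI;; Decr rInner))%cmd Q s0.
Proof.
move=> hm ha cs0 hhp0 hso0 hM0 hI0 hIn0 HQ.
pose L := [:: rI; rInner; rP; rQ; rJ; rTmp; rA; rB].
pose rows_to k := pre ++ flatten [seq printed_row m (- (3 * T%:Z) + j%:Z) | j <- iota 0 k].
pose I n s := exists k : nat, [/\ changes_only L s0 s, hp s = h, so s = rows_to k,
  rg s rI = - (3 * T%:Z) + k%:Z & [/\ rg s rInner = 6 * T%:Z + K - k%:Z,
  k%:Z < 6 * T%:Z + K & 6 * T%:Z + K - k%:Z <= n%:Z]].
apply: (wp_repeat (I := I)); last first.
- exists 0%N; split=> //; try by lia.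
    by rewrite /rows_to cats0.
  by split; lia.
- by move=> s [k [_ _ _ _ [_ h1 h2]]]; lia.
move=> n s [k [cl hhp hso hI [hIn hk hn]]].
have cs : consts s by apply: consts_changes_only cl _ cs0.
pose i := - (3 * T%:Z) + k%:Z.
have hi : - (3 * T%:Z) <= i < 3 * T%:Z + K by rewrite /i; lia.
rewrite wp_seq; apply: (wp_locate cs hI (m := m)); try by lia.
  by rewrite cl.
rewrite -/i => s1 cl1 hp1 so1 hP1 hQ1.
pose J j s' := [/\ changes_only L s0 s', hp s' = h,
  so s' = rows_to k ++ [seq entry m i y | y <- iota 0 j], rg s' rI = i &
  [/\ rg s' rInner = 6 * T%:Z + K - k%:Z, rg s' rP = addr i (N + j) &
     rg s' rQ = addr (i - m) j]].
rewrite wp_seq; apply: (wp_For (I := J)).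
- split; rewrite ?hp1 ?so1 ?addn0 ?cats0 //.
  + apply: changes_only_trans cl _; apply: changes_only_sub cl1 => r.
    by rewrite !inE => /or4P[] /eqP ->.
  + by rewrite cl1.
  + by split=> //; rewrite cl1.
- move=> j s' hj [cl' hhp' hso' hI' [hIn' hP' hQ']].
  have [g1 g2 b1 b2 [v1 v2 eb]] := cells_at hm ha hi hj.
  have cs' : consts s' by apply: consts_changes_only cl' _ cs0.
  have [z0 one _ _ _] := cs'.
  rewrite /= hP' hhp' v1 hQ' v2 one; split; first by [].
  split; first by [].
  rewrite -/(entry m i j); split; first by rewrite /fits; lia.
  do 2 (split; first by []).
  split=> //; first by track_changes.
    by rewrite -(addn1 j) iotaD map_cat catA cats1 -hso'.
  by split; rewrite ?addrS ?addnS.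
- move=> s' [cl' hhp' hso' hI' [hIn' hP' hQ']].
  have cs' : consts s' by apply: consts_changes_only cl' _ cs0.
  have [z0 one _ _ _] := cs'.
  rewrite /= one hI' hIn'; split; first by rewrite /fits; lia.
  split; first by rewrite /fits; lia.
  have soS : so s' = rows_to k.+1.
    rewrite hso' /rows_to -(addn1 k) iotaD map_cat flatten_cat catA /= cats0.
    by [].
  case: ifP => hlt.
    exists k.+1; split=> //=; first by track_changes.
      by rewrite /i; lia.
    by split; lia.
  apply: HQ; rewrite /= soS /rows_to.
  by have -> : k.+1 = (6 * T + `|K|)%N by lia.
Qed.

Lemma wp_output (Q : state -> Prop) s :
  consts s -> holds_array (hp s) q -> so s = [::] -> found s (2 * T%:Z) ->
  (forall s', (forall m, - (2 * T%:Z) <= m < 2 * T%:Z -> ~ matching_shift m) ->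
     so s' = [:: 0] -> Q s') ->
  (forall s' m, - (2 * T%:Z) <= m < 2 * T%:Z -> matching_shift m -> so s' = printed m -> Q s') ->
  wp (output N) Q s.
Proof.
move=> cs ha hso fd HQ0 HQ1; have [z0 one hT hO [hK hku _ hnq]] := cs.
case: fd => [[e a]|[e hm g]].
  rewrite /output; move: (print_conjugator N) => L /=; rewrite e /= one z0.
  split; first by rewrite /fits; lia.
  by apply: HQ0 a _ => /=; rewrite hso.
rewrite /output; move E: (print_conjugator N) => L /=; rewrite e /= one -{}E {L}.
split; first by rewrite /fits; lia.
move: hm g HQ1; set m := rg s rRes => hm g HQ1.
rewrite /print_conjugator; move E: (Repeat _ _ _) => L /=.
rewrite one hT hK -/m z0 ?hso /=.
do 6 (split; first by rewrite /fits; lia).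
pose e0 := - (3 * T%:Z) + if ku < 0 then K else 0.
have fin s1 : consts s1 -> hp s1 = hp s -> so s1 = [:: 1; m; e0] -> rg s1 rM = m ->
    rg s1 rI = - (3 * T%:Z) -> rg s1 rInner = 6 * T%:Z + K -> wp L Q s1.
  move=> cs1 hp1 so1 hM1 hI1 hIn1; rewrite -E.
  apply: (wp_print_rows hm ha cs1 hp1 so1 hM1 hI1 hIn1) => s' hs'.
  by apply: HQ1 hm g _; rewrite hs'.
apply: wp_ifneg => //=; rewrite hku; first by rewrite /fits; lia.
  move=> neg; rewrite hK z0; split; first by rewrite /fits; lia.
  split; first by rewrite -/m /fits; lia.
  apply: fin => //=; rewrite -/m ?hso ?addr0 //.
  - by rewrite /e0 neg; congr [:: _; _; _]; lia.
  - by lia.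
  - by lia.
move=> nneg; rewrite -/m z0 addr0; split; first by rewrite /fits; lia.
apply: fin => //=; rewrite ?hso //; try by lia.
rewrite /e0; have -> : (ku < 0) = false by lia.
by rewrite !addr0; congr [:: _; _; _]; lia.
Qed.

End Search.

End Phases.

(** * Running time *)

Section Cost.

Definition time_order (k : nat) (c : cmd) : Prop :=
  exists C, forall T, 0 < T -> cost c T <= C * T ^ k.

Lemma time_order_basic k c : (forall T, cost c T <= 1) -> time_order k c.
Proof.
move=> h; exists 1 => T T0; rewrite mul1n.
by apply: leq_trans (h T) _; rewrite expn_gt0 T0.
Qed.

Lemma time_order_Seq k c1 c2 : time_order k c1 -> time_order k c2 -> time_order k (Seq c1 c2).
Proof.
move=> [C1 h1] [C2 h2]; exists (C1 + C2) => T T0 /=.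
by rewrite mulnDl leq_add ?h1 ?h2.
Qed.

Lemma time_order_Unless k r c : time_order k c -> time_order k (Unless r c).
Proof.
move=> [C h]; exists C.+1 => T T0 /=; rewrite mulSn -add1n leq_add ?h //.
by rewrite expn_gt0 T0.
Qed.

Lemma time_order_Repeat k B r c :
  (exists b, forall T, B T <= b * T) -> time_order k c -> time_order k.+1 (Repeat B r c).
Proof.
move=> [b hb] [C h]; exists (b * C.+1) => T T0 /=.
rewrite expnS mulnACA; apply: leq_mul; first exact: hb.
by rewrite mulSn -add1n leq_add ?h // expn_gt0 T0.
Qed.

Lemma time_order_For k n f : (forall j, time_order k (f j)) -> time_order k (For n f).
Proof.
move=> h; elim: n => [|n IH] /=; first exact: time_order_basic.
exact: time_order_Seq.
Qed.

End Cost.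

(* The order of the cost is read off the nesting of the loops, in the text of the
   commands. *)
#[local] Transparent IfPos IfNeg address read_word read_input setup plot_word.
Ltac time_order_tac := repeat lazymatch goal with
  | |- time_order _ (Seq _ _) => apply: time_order_Seq
  | |- time_order _ (Unless _ _) => apply: time_order_Unless
  | |- time_order _ (Repeat _ _ _) => apply: time_order_Repeat;
    [first [by exists 1 => T; rewrite mul1n | by eexists => T; apply: leqnn] |]
  | |- time_order _ (For _ _) => apply: time_order_For => ?
  | |- time_order _ (Const _ _) => exact: time_order_basic
  | |- time_order _ (Plus _ _ _) => exact: time_order_basic
  | |- time_order _ (Minus _ _ _) => exact: time_order_basic
  | |- time_order _ (Get _ _) => exact: time_order_basic
  | |- time_order _ (Put _ _) => exact: time_order_basic
  | |- time_order _ (Read _) => exact: time_order_basic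
  | |- time_order _ (Emit _) => exact: time_order_basic
  | |- time_order _ Skip => exact: time_order_basic
  | |- time_order _ (match ?x with _ => _ end) => case: x => [|?]
  | |- time_order ?k ?c => let c' := eval red in c in change (time_order k c')
  end.

Lemma time_order_main N d b G : time_order 2 (main N d b G).
Proof. by time_order_tac. Qed.

(** * From the printed answer to the group *)

Lemma map_enum_rank (I : finType) : [seq enum_rank x : nat | x <- enum I] = iota 0 #|I|.
Proof.
apply: (@eq_from_nth _ 0) => [|i]; first by rewrite size_map size_iota -cardE.
rewrite size_map -cardE => hi; rewrite nth_iota // add0n.
have x0 : I by case: (pickP I) => [x _|/eq_card0 e] //; rewrite e in hi.
rewrite (nth_map x0) -?cardE //.
by rewrite -[i]/(val (Ordinal hi)) -enum_val_nth enum_valK.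
Qed.

Section Answer.
Local Open Scope ring_scope.
Variables (R : comPzRingType) (X : {fset R}).
Notation N := #|{: X}|.
Variables (T V : nat) (d : nat -> nat).
Variables (u v : word X) (K sg nq : int).
Notation ku := (expo u).
Notation kv := (expo v).
Hypothesis hT : T = (size u + size v + 2)%N.
Hypothesis hK : K = (if ku == 0 then 8 * T%:Z else `|ku|).
Hypothesis hsg : sg = (if ku < 0 then - 1 else 1).
Hypothesis hnq : nq = (ku != kv)%:R.
Hypothesis d_pivot : forall i c, lin X c = 0 ->
  (forall j, (j < i)%N -> c j = 0) -> (d i %| c i)%Z.

Definition sums : int -> nat -> int :=
  side_by_side X (wsum K (marks sg 0 u)) (wsum K (marks sg 0 v)).

Variable q : int -> nat -> int.
Hypothesis hq : forall i, i < 15 * T%:Z -> normal_row X T d V sums q i.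

Definition prefP (i : int) : R := lin X (wsum K (marks sg 0 u) i).
Definition prefQ (i : int) : R := lin X (wsum K (marks sg 0 v) i).

Let eu := expo_bound u.
Let ev := expo_bound v.
Let K0 : 0 < K. Proof. by rewrite hK; case: eqP; lia. Qed.

Lemma lin_left i : i < 15 * T%:Z -> lin X (q i) = prefP i.
Proof.
move=> /hq[[-> _ _] _]; apply: eq_lin => y hy.
by rewrite /sums /side_by_side hy.
Qed.

Lemma lin_right i : i < 15 * T%:Z -> lin X (fun y => q i (N + y)%N) = prefQ i.
Proof.
move=> /hq[_ [-> _ _]]; apply: eq_lin => y hy.
by rewrite /sums /side_by_side ltnNge leq_addr /= addKn.
Qed.

Lemma lin_entry m i : - (2 * T%:Z) <= m < 2 * T%:Z -> i <= 11 * T%:Z ->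
  lin X (entry X q m i) = prefQ i - prefP (i - m).
Proof. by move=> hm hi; rewrite linB lin_left ?lin_right //; lia. Qed.

(** The program compares normal forms, which are equal exactly when the elements
    of R are. *)
Lemma matching_shiftP m : - (2 * T%:Z) <= m < 2 * T%:Z ->
  matching_shift X T K nq q m <-> ku = kv /\ shift_matches T%:Z K prefP prefQ m.
Proof.
move=> hm; have K8 : K <= 8 * T%:Z by rewrite hK; case: eqP; lia.
have nqE : nq = 0 <-> ku = kv.
  by rewrite hnq; case: eqP => [->|]; split.
split=> [[/nqE e h]|[/nqE e h]]; split=> // i.
  move=> hi; apply/eqP; rewrite -subr_eq0 -lin_entry //; last by lia.
  by apply/eqP; rewrite -(lin0 X); apply: eq_lin => y hy; apply: h.
move=> y hi hy; rewrite /entry; apply/eqP; rewrite subr_eq0; apply/eqP.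
have [|_ [_ n1 _]] := hq (i := i); first by lia.
have [|[_ n2 _] _] := hq (i := i - m); first by lia.
apply: (normal_inj (Ker := fun c => lin X c = 0) d_pivot n1 n2) => //.
by rewrite linBM mulr1z lin_left ?lin_right ?h ?subrr //; lia.
Qed.

Let cases : [\/ [/\ 0 < ku, ku < T%:Z, K = ku & sg = 1],
  [/\ ku < 0, - T%:Z < ku, K = - ku & sg = - 1] | [/\ ku = 0, K = 8 * T%:Z & sg = 1]].
Proof.
rewrite hK hsg; case: (ltgtP ku 0) => h.
- by apply: Or32; split=> //; lia.
- by apply: Or31; split=> //; lia.
- by apply: Or33.
Qed.

Let supp (w : word X) : (size w < T)%N ->
  forall i : int, (i <= - T%:Z) || (T%:Z <= i) -> (word_value w).1@_i = 0.
Proof.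
move=> hw i hi; have := lin_coef 1 0 w i; rewrite subr0 mulr1z => <-; rewrite -(lin0 X).
by apply: eq_lin => y _; apply: coef_out; lia.
Qed.

Let pre (w : word X) : (size w < T)%N ->
  prefix_of T%:Z K sg (word_value w).1 (fun i => lin X (wsum K (marks sg 0 w) i)).
Proof.
move=> hw; split=> i.
  have := lin_coef sg 0 w i; rewrite subr0 => <-; rewrite -linD; apply: eq_lin => y _.
  by rewrite wsum_rec.
by move=> hi; rewrite -(lin0 X); apply: eq_lin => y _; apply: wsum_out; lia.
Qed.

Lemma word_valueE (w : word X) : word_value w = ((word_value w).1, expo w) :> gamma2 R.
Proof. by rewrite -word_value2; case: (word_value w). Qed.

Lemma answer_no : (forall m, - (2 * T%:Z) <= m < 2 * T%:Z -> ~ matching_shift X T K nq q m) ->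
  correct_answer X (word_value u) (word_value v) [:: 0].
Proof.
move=> no; split=> // cj; exfalso.
have kk : ku = kv.
  by case: cj => -[F m]; rewrite (word_valueE u) (word_valueE v) => /conj_coefP[].
have T0 : 0 < T%:Z by lia.
have su : (size u < T)%N by lia.
have sv : (size v < T)%N by lia.
rewrite (word_valueE u) (word_valueE v) -kk in cj.
have [m hm sm] := conj_shift_matches T0 cases (supp su) (supp sv) (pre su) (pre sv) cj.
by apply: (no m hm); apply/matching_shiftP.
Qed.

Lemma answer_yes m : - (2 * T%:Z) <= m < 2 * T%:Z -> matching_shift X T K nq q m ->
  correct_answer X (word_value u) (word_value v) (printed X T K ku q m).
Proof.
move=> hm /(matching_shiftP hm)[kk sm].
have T0 : 0 < T%:Z by lia.
have su : (size u < T)%N by lia.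
have sv : (size v < T)%N by lia.
pose e := - (3 * T%:Z) + (if ku < 0 then K else 0).
pose len := (6 * T + `|K|)%N.
pose cs : seq {ffun X -> int} :=
  [seq [ffun x : X => entry X q m (- (3 * T%:Z) + j%:Z) (enum_rank x)] | j <- iota 0 len].
pose F : laurent R := \sum_(j < size cs) << lincomb (nth [ffun=> 0] cs j) *g e + j%:Z >>.
suff cj : (((F, m) : gamma2 R) * word_value u = word_value v * ((F, m) : gamma2 R))%g.
  split=> [_|]; last by case; exists (F, m).
  exists (F, m), (behead (printed X T K ku q m)); split=> //.
  exists e, cs; split=> //=; congr [:: _, _ & flatten _].
  rewrite -map_comp; apply: eq_map => j /=.
  rewrite /printed_row -map_enum_rank -map_comp.
  by apply: eq_map => x /=; rewrite ffunE.
have K8 : K <= 8 * T%:Z by rewrite hK; case: eqP; lia.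
have hm' : - (2 * T%:Z) <= m <= 2 * T%:Z by lia.
rewrite (word_valueE u) (word_valueE v) -kk.
apply: (shift_matches_conj T0 cases (supp su) (supp sv) (pre su) (pre sv) hm' sm) => i.
have scs : size cs = len by rewrite size_map size_iota.
have FE : F@_i = \sum_(j < len)
    (prefQ (- (3 * T%:Z) + j%:Z) - prefP (- (3 * T%:Z) + j%:Z - m)) *+ (e + j%:Z == i).
  rewrite /F scs raddf_sum /=; apply: eq_bigr => j _.
  rewrite mcoeffU; congr (_ *+ _); rewrite -lin_entry //; last first.
    by have := ltn_ord j; rewrite /len; lia.
  by rewrite (nth_map 0%N) ?size_iota // nth_iota.
rewrite {}FE -[RHS]/(shifted_diff prefP prefQ m (i - _)).
have ei : e = - (3 * T%:Z) + (if ku < 0 then K else 0) by [].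
move: ei; set sh := (if ku < 0 then K else 0) => ei.
have [hi|hi] := boolP (e <= i < e + len%:Z).
  have hj : (`|i - e| < len)%N by lia.
  rewrite (bigD1 (Ordinal hj)) //= big1 ?addr0 => [|j /eqP ne].
    have -> : e + `|i - e|%N%:Z == i by lia.
    have -> : - (3 * T%:Z) + `|i - e|%N%:Z = i - sh by lia.
    by [].
  have -> : (e + j%:Z == i) = false; last by [].
  apply/negbTE/negP => /eqP ej; apply: ne; apply/val_inj => /=; lia.
rewrite big1 => [|j _]; last first.
  have -> : (e + j%:Z == i) = false; last by [].
  by have := ltn_ord j; lia.
apply/esym; have [h|h] := ltP i e.
  by apply: (diff_low T0 cases (pre su) (pre sv) hm'); lia.
by apply: (diff_high T0 cases (supp su) (supp sv) (pre su) (pre sv) hm' sm); lia.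
Qed.

End Answer.

Lemma exists_bound (N : nat) (f : nat -> nat -> int) :
  exists M : nat, forall i j, i < N -> j < N -> (`|f i j| <= M%:Z)%R.
Proof.
exists (\sum_(i < N) \sum_(j < N) `|f i j|)%N => i j iN jN.
rewrite (bigD1 (Ordinal iN)) //= (bigD1 (Ordinal jN)) //=; lia.
Qed.

Section MainCorrect.
Variables (R : comPzRingType) (X : {fset R}).
Notation N := #|{: X}|.
Variables (d : nat -> nat) (b : nat -> nat -> int) (M : nat).
Let g := 1 + 5 * M.
Hypothesis db : forall i,
    [/\ lin X (b i) = 0, forall j, (j < i)%N -> b i j = 0, b i i = (d i)%:Z &
      forall c, lin X c = 0 -> (forall j, (j < i)%N -> c j = 0) -> (d i %| c i)%Z]%R.
Hypothesis bM : forall i j, i < N -> j < N -> (`|b i j| <= M%:Z)%R.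

Lemma wp_main (u v : word X) (T W : nat) :
  T = size u + size v + 2 ->
  nregs + 2 * N + 64 * T + 64 * (width N * T) < W ->
  8 * (T * g ^ N) + 8 * M + 8 * T < W ->
  wp T W (main N d b (g ^ N + 4))
    (fun s => correct_answer X (word_value u) (word_value v) (so s))
    (blank (input_code u v)).
Proof.
move=> hT HW HV; have T0 : 0 < T by rewrite hT addn2.
pose ku := expo u; pose kv := expo v.
pose O : int := (nregs%:Z + T%:Z + 16 * (width N)%:Z * T%:Z)%R.
pose K : int := (if ku == 0 then 8 * T%:Z else `|ku|)%R.
pose sg : int := (if ku < 0 then - 1 else 1)%R.
pose nq : int := ((ku != kv)%:R)%R.
have eu := expo_bound u; have ev := expo_bound v.
have HK : (0 < K <= 8 * T%:Z)%R by rewrite /K; case: eqP; lia.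
have hsg : (`|sg| <= 1)%R by rewrite /sg; case: ifP.
have bpiv k c : lin X c = 0%R -> (forall j, j < k -> c j = 0%R) -> (d k %| c k)%Z.
  by case: (db k) => _ _ _; apply.
rewrite /main wp_seq; apply: (wp_read_input T0 HW hT) => //.
move=> s0 hso0 htp z0 one0 hptr hku hkv.
rewrite wp_seq; apply: (wp_setup T0 HW (erefl O) HK (erefl K) (erefl sg) (erefl nq)) => //;
  try by rewrite /ku /kv; lia.
move=> s1 cs1 hp1 so1; rewrite hso0 in so1.
rewrite wp_seq; apply: (wp_plot_input T0 HW (erefl O) HK hT hsg cs1) => //.
  by move=> j; rewrite hp1.
move=> s2 cs2 so2 a2; rewrite so1 in so2.
have su : size u < T by lia.
have sv : size v < T by lia.
have r_rec i y : (sums u v K sg i y =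
    side_by_side X (coef (marks sg 0 u)) (coef (marks sg 0 v)) i y +
    sums u v K sg (i - K) y)%R.
  by rewrite /sums /side_by_side; case: ifP => _; apply: wsum_rec; case/andP: HK.
have r_low i y : (i < - T%:Z -> sums u v K sg i y = 0)%R.
  by move=> hi; rewrite /sums /side_by_side; case: ifP => _; apply: wsum_out; lia.
have r_bound i y : (`|sums u v K sg i y| <= T%:Z)%R.
  rewrite /sums /side_by_side; case: ifP => _.
    by apply: le_trans (wsum_bound _ _ _ _ _ hsg) _; lia.
  by apply: le_trans (wsum_bound _ _ _ _ _ hsg) _; lia.
rewrite wp_seq; apply: (wp_prefix T0 HW (erefl O) HK r_rec r_low r_bound cs2 a2) => //.
move=> s3 cs3 so3 a3.
rewrite so2 in so3.
rewrite wp_seq; apply: (wp_normalize T0 HW (erefl O) HK (r := sums u v K sg) bM _ _ _ HV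
  r_bound r_low cs3 a3).
- by move=> k; case: (db k).
- by move=> k y; case: (db k) => _ h _ _ /h.
- by move=> k; case: (db k).
move=> s4 q cs4 so4 a4 ta; rewrite so3 in so4.
pose V := T * g ^ N; have HV' : 8 * V + 8 * T < W by lia.
have ku_T : (`|ku| < T%:Z)%R by rewrite /ku; lia.
have nq01 : (nq = 0 \/ nq = 1)%R by rewrite /nq; case: (_ != _); [right | left].
have q_bound i y : (i < 15 * T%:Z -> (y < width N)%N -> `|q i y| <= V%:Z)%R.
  move=> hi hy; have [[_ _ b1] [_ _ b2]] := ta i hi.
  have [yN|yN] := ltnP y N; first exact: b1.
  have yN' : y - N < N by rewrite /width in hy; lia.
  by have := b2 _ yN'; rewrite /= subnKC.
rewrite wp_seq; apply: (wp_search T0 HW (erefl O) HK HV' ku_T nq01 q_bound cs4 a4) => //.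
move=> s5 cs5 hp5 so5 fd5.
rewrite so4 in so5; rewrite -hp5 in a4.
apply: (wp_output T0 HW (erefl O) HK HV' ku_T nq01 q_bound cs5 a4 so5 fd5).
- by move=> s6 no ->; exact: (answer_no hT (erefl K) (erefl sg) (erefl nq) bpiv ta no).
- by move=> s6 m hm gm ->;
    exact: (answer_yes hT (erefl K) (erefl sg) (erefl nq) bpiv ta hm gm).
Qed.

End MainCorrect.

Theorem theorem9 (R : comPzRingType) (X : {fset R})
    (hX : generates_additively X) :
  exists (p : program) (c : nat), forall u v : word X,
    exists (t : nat) (out : seq int),
      let n := size u + size v in
      [/\ t <= c * n ^ 2 + c,
          runs_to p (input_code u v) t ((n + 2) ^ c) out
        & correct_answer X (word_value u) (word_value v) out].
Proof.
have [d [b db]] : exists (d : nat -> nat) (b : nat -> nat -> int), forall i,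
    [/\ lin X (b i) = 0, forall j, (j < i)%N -> b i j = 0, b i i = (d i)%:Z &
      forall c, lin X c = 0 -> (forall j, (j < i)%N -> c j = 0) -> (d i %| c i)%Z]%R.
  apply: triangular_relations => [|c c' z h h']; first exact: lin0.
  by rewrite linBM h h' mul0rz subrr.
pose N := #|{: X}|; have [M bM] := exists_bound N b.
pose g := 1 + 5 * M; pose G := g ^ N + 4.
have [C costC] := time_order_main N d b G.
pose D := nregs + 2 * N + 72 + 64 * width N + 8 * g ^ N + 8 * M.
exists (compile 0 (main N d b G)), (5 * C + D.+1) => u v.
pose T := size u + size v + 2; pose W := T ^ (5 * C + D.+1).
have T2 : 2 <= T by rewrite /T addn2.
have T0 : 0 < T by apply: ltnW.
have DW : D * T < W.
  apply: (@leq_trans (T ^ D.+1)); last by rewrite leq_exp2l // leq_addl.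
  (* As T >= 2, a constant factor is absorbed by a power of T. *)
  rewrite expnS mulnC ltn_pmul2l //; apply: (@leq_trans (2 ^ D)).
    by apply: ltn_expl.
  by case: (D) => // D'; rewrite leq_exp2r.
have HW : nregs + 2 * N + 64 * T + 64 * (width N * T) < W.
    by apply: leq_trans DW; rewrite /D; nia.
have HV : 8 * (T * g ^ N) + 8 * M + 8 * T < W.
    by apply: leq_trans DW; rewrite /D; nia.
have [|t [out [ht run ans]]] := @wp_runs_to T W (main N d b G) (input_code u v)
  (correct_answer X (word_value u) (word_value v)); first exact: (wp_main db bM).
exists t, out => n; split=> //.
apply: leq_trans ht _; apply: leq_trans (costC T T0) _.
have hT : T ^ 2 <= 5 * n ^ 2 + 4 by rewrite /T -/n -!mulnn; nia.
apply: leq_trans (leq_mul (leqnn C) hT) _; rewrite mulnDr mulnA [C * 5]mulnC.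
by apply: leq_add; [rewrite leq_mul2r leq_addr orbT | lia].
Qed.
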